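(* Let $R\ge n^{50}$ (with $R$ larger than a suitable absolute constant) be an integer and let $\mathcal I$ be a distribution on $\mathbb Z^n$ whose support has Euclidean diameter at most $D\le R^{1/3}$. Consider the exact stream distribution of radius $R$ associated with $\mathcal I$. Assume there is a randomized turnstile streaming algorithm using $S$ bits of space which solves a streaming problem on the exact stream distribution with success probability at least $1-\delta$. Then there exists a deterministic linear sketch $\mathcal A$ of dimension $O(S)$ with image size at most $(2+\frac{S}{\log R})^{O(S)}$ satisfying the corresponding conclusion: (1) For a metric approximation problem with metric space $(\mathcal M,d)$, target $f:\mathbb Z^n\to\mathcal M$, admissible outputs $\mathcal O\subseteq\mathcal M$ and accuracy $\epsilon\ge0$ (solved by the streaming algorithm), there is a decoder $g:\mathcal A(\mathbb Z^n)\to\mathcal O$ with $\Pr_{Y\sim\mathcal I}[d(g(\mathcal A(Y)),f(Y))\le 3\epsilon]\ge 1-8\delta$. (2) For a promise problem $f:\mathbb Z^n\to\{0,1,*\}$ (solved by the streaming algorithm), there is a decoder $g:\mathcal A(\mathbb Z^n)\to\{0,1\}$ with $\Pr_{Y\sim\mathcal I}[g(\mathcal A(Y))=f(Y)]\ge1-8\delta$ (where $b=f(y)$ means $f(y)=*$ or $b=f(y)$). (3) For an arbitrary streaming problem with output set $\mathcal O$ and relation $\mathcal R\subseteq\mathbb Z^n\times\mathcal O$ (solved by the streaming algorithm), if $R\ge\delta^{-50}$, there is a randomized map $g$ from $\mathcal A(\mathbb Z^n)$ to $\mathcal O$ with $\Pr_{Y\sim\mathcal I,\ o\sim g(\mathcal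 A(Y))}[(Y,o)\in\mathcal R]\ge1-3\delta$.
   Context: $\log$ is base two. $\gamma_R(x)=e^{-\pi\|x\|_2^2/R^2}/\sum_{y\in\mathbb Z^n}e^{-\pi\|y\|_2^2/R^2}$ on $\mathbb Z^n$; $\gamma_R^{\mathrm{tr}}$ is $\gamma_R$ conditioned on a centered Euclidean ball of radius $\Theta(R(\sqrt n+\ln R))$ chosen so that the discarded mass is at most $R^{-100}$. For $v\in\mathbb Z^n$, $\mathsf{can}(v)$ is the unit update block performing, for $i=1,\dots,n$ in order, $|v_i|$ updates on coordinate $i$ with sign $\mathrm{sgn}(v_i)$. Exact stream distribution: $M=R^2$; $X_1,\dots,X_M$ i.i.d. $\gamma_R^{\mathrm{tr}}$; independent $Y\sim\mathcal I$; $a=Y-(X_1+\dots+X_M)$; the stream is $\mathsf{can}(X_1),\dots,\mathsf{can}(X_M),\mathsf{can}(a)$ followed by the query (final frequency vector $Y$). A randomized turnstile streaming algorithm using $S$ bits is a public-coin family of deterministic streaming algorithms each with at most $2^S$ memory states (seed not counted). A streaming problem is a relation $\mathcal R\subseteq\mathbb Z^n\times\mathcal O$ of acceptable outputs; metric approximation problems (valid outputs $z\in\mathcal O$ with $d(z,f(x))\le\epsilon$) and promise problems are special cases. ''Solves on a distribution with success probability $\ge1-\delta$'' means the output is valid for the final frequency vector with probability $\ge1-\delta$ over the random stream and the seed. A deterministic linear sketch is a group homomorphism $\mathcal A:\mathbb Z^n\to\Gamma$ into an abelian group (here a product of $m$ copies of $\mathbb R/\mathbb Z$ or $\mathbb Z$,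 $m$ = dimension); image size is $|\mathcal A(\mathbb Z^n)|$. *)

(* Defs.v *)
From HB Require Import structures.
From mathcomp Require Import all_boot all_order all_algebra.
From mathcomp Require Import finmap.
From mathcomp Require Import all_classical all_reals all_analysis.
Set Implicit Arguments.
Unset Strict Implicit.
Unset Printing Implicit Defensive.
Import Order.TTheory GRing.Theory Num.Theory.
Import numFieldNormedType.Exports.
Local Open Scope classical_set_scope.
Local Open Scope ring_scope.
Local Open Scope quotient_scope.

(* Z^n is ['rV[int]_n]; [r : nat] is the integer radius of the discrete Gaussian. *)

Section Distributions.
Context {R : realType} {T : choiceType}.

Definition is_pmf (p : T -> R) :=
  (forall x, 0 <= p x) /\ \esum_(x in [set: T]) (p x)%:E = 1%E.

Definition prob (p : T -> R) (A : set T) : \bar R := \esum_(x in A) (p x)%:E.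

Definition conditioned (p : T -> R) (A : set T) (x : T) : R :=
  if x \in A then p x / fine (prob p A) else 0.

End Distributions.

Section Gaussian.
Context {R : realType} (n : nat).

Definition l2norm (v : 'rV[int]_n) : R :=
  Num.sqrt (\sum_(i < n) ((v ord0 i)%:~R ^+ 2)).

Definition support_diam_le (p : 'rV[int]_n -> R) (D : R) :=
  forall x y, p x != 0 -> p y != 0 -> l2norm (x - y) <= D.

Definition gauss_weight (r : nat) (x : 'rV[int]_n) : R :=
  expR (- pi * l2norm x ^+ 2 / r%:R ^+ 2).

Definition discrete_gauss (r : nat) (x : 'rV[int]_n) : R :=
  gauss_weight r x / fine (\esum_(y in [set: 'rV[int]_n]) (gauss_weight r y)%:E).

Definition euclid_ball (rho : R) : set 'rV[int]_n := [set x | l2norm x <= rho].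

Definition trunc_gauss (r : nat) (rho : R) : 'rV[int]_n -> R :=
  conditioned (discrete_gauss r) (euclid_ball rho).

(* [c1], [c2] are the two constants hidden in
   rho = Theta(r * (sqrt n + ln r)). *)
Definition truncation_radius (c1 c2 : R) (r : nat) (rho : R) :=
  let scale := r%:R * (Num.sqrt n%:R + ln r%:R) in
  [/\ c1 * scale <= rho, rho <= c2 * scale &
      (prob (discrete_gauss r) (~` euclid_ball rho) <= (r%:R ^- 100)%:E)%E].

End Gaussian.

Section Streaming.
Context {n : nat}.

(* [(i, b)] adds [(-1) ^+ b] to coordinate [i]. *)
Definition update := ('I_n * bool)%type.

Definition freq (s : seq update) : 'rV[int]_n :=
  \sum_(u <- s) (-1) ^+ u.2 *: delta_mx ord0 u.1.

Definition can (v : 'rV[int]_n) : seq update :=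
  flatten [seq nseq `|v ord0 i|%N (i, v ord0 i < 0) | i <- enum 'I_n].

Record det_alg (O : Type) := DetAlg {
  state : finType;
  start : state;
  step : state -> update -> state;
  answer : state -> O
}.

Definition run (O : Type) (a : det_alg O) (s : seq update) : O :=
  answer (foldl (@step _ a) (start a) s).

Definition exact_stream (M : nat) (y : 'rV[int]_n) (x : {ffun 'I_M -> 'rV[int]_n}) :
    seq update :=
  flatten [seq can (x j) | j <- enum 'I_M] ++ can (y - \sum_(j < M) x j).

(* The frequency vector of the exact stream is the sample [Y] it was built from. *)
Lemma freq_can (v : 'rV[int]_n) : freq (can v) = v.
Proof.
rewrite /freq /can big_flatten /= big_map big_enum /=.
rewrite [RHS]matrix_sum_delta big_ord1.
apply: eq_bigr => i _; rewrite big_nseq_cond /= iter_addr addr0.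
rewrite -scaler_nat scalerA natz abszE.
by congr (_ *: _); rewrite [RHS]numEsign mulrC.
Qed.

Lemma freq_exact_stream M y x : freq (@exact_stream M y x) = y.
Proof.
rewrite /exact_stream /freq big_cat /= -!/(freq _) freq_can.
rewrite /freq big_flatten /= big_map big_enum /=.
rewrite (eq_bigr x) => [|j _]; last exact: freq_can.
by rewrite addrC subrK.
Qed.

End Streaming.
Arguments update : clear implicits.
Arguments det_alg : clear implicits.

Section Solving.
Context {R : realType} {n : nat} {O : Type}.

(* Joint law of [(Y, (X_1, ..., X_M))], with [M = r ^ 2]. *)
Definition exact_pmf (r : nat) (rho : R) (I : 'rV[int]_n -> R)
    (z : 'rV[int]_n * {ffun 'I_(r ^ 2) -> 'rV[int]_n}) : R :=
  I z.1 * \prod_(j < r ^ 2) trunc_gauss r rho (z.2 j).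

Definition valid_seeds (rel : 'rV[int]_n -> O -> Prop) (T : Type)
    (alg : T -> det_alg n O) (s : seq (update n)) : set T :=
  [set w | rel (freq s) (run (alg w) s)].

(* The seed [w] has law [P] and is independent of the stream.  Measurability of
   the success event given the stream is what makes its probability meaningful. *)
Definition solves_on_exact (r : nat) (rho : R) (I : 'rV[int]_n -> R)
    (rel : 'rV[int]_n -> O -> Prop) (delta : R)
    (d : measure_display) (T : measurableType d) (P : probability T R)
    (alg : T -> det_alg n O) :=
  (forall y (x : {ffun 'I_(r ^ 2) -> 'rV[int]_n}),
     measurable (valid_seeds rel alg (exact_stream y x))) /\
  ((1 - delta)%:E <=
   \esum_(z in [set: 'rV[int]_n * {ffun 'I_(r ^ 2) -> 'rV[int]_n}])
      ((exact_pmf rho I z)%:E *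
       P (valid_seeds rel alg (exact_stream z.1 z.2))))%E.

Definition solvable_in_space (r : nat) (rho : R) (I : 'rV[int]_n -> R)
    (rel : 'rV[int]_n -> O -> Prop) (delta : R) (s : nat) :=
  exists (d : measure_display) (T : measurableType d) (P : probability T R)
         (alg : T -> det_alg n O),
    (forall w, (#|state (alg w)| <= 2 ^ s)%N) /\
    solves_on_exact r rho I rel delta P alg.

End Solving.

Definition metric_rel (R : realType) (n : nat) (M : metricType R)
    (f : 'rV[int]_n -> M) (outs : set M) (eps : R)
    (y : 'rV[int]_n) (z : outs) : Prop :=
  mdist (\val z) (f y) <= eps.
Arguments metric_rel {R n M} f outs eps.

(* [None] is the value [*] of a promise problem. *)
Definition promise_rel (n : nat) (f : 'rV[int]_n -> option bool)
    (y : 'rV[int]_n) (b : bool) : Prop :=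
  f y = None \/ f y = Some b.

(* R/Z, the quotient of the additive group R by its subgroup of integers. *)
Definition circle (R : realType) : zmodType :=
  {ideal_quot GRing.ZmodClosed.clone R Num.int_num_subdef _}.

Lemma eq_circle (R : realType) (x y : R) :
  \pi_(circle R) x = \pi_(circle R) y <-> x - y \is a Num.int.
Proof.
rewrite -[_ \is a _]/(x - y \in GRing.ZmodClosed.clone R Num.int_num_subdef _).
by rewrite Quotient.idealrBE; split=> [->|/eqP].
Qed.

(* A product of p copies of R/Z and q copies of Z; its dimension is p + q. *)
Definition sketch_group (R : realType) (p q : nat) : zmodType :=
  ('rV[circle R]_p * 'rV[int]_q)%type.

Definition linear_sketch (R : realType) (n p q : nat) : Type :=
  {additive 'rV[int]_n -> sketch_group R p q}.

Definition log2 (R : realType) (x : R) : R := ln x / ln 2.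

Definition sketch_within (R : realType) (n p q : nat)
    (A : linear_sketch R n p q) (C r s : nat) :=
  [/\ (p + q <= C * s)%N, finite_set (range A) &
      (#|` fset_set (range A)|)%:R <= (2 + s%:R / log2 (r%:R : R)) ^+ (C * s)].

(* Main.v *)
(** The proof combines an entropy argument with a lattice construction.

Fix a good seed and then a good path of memory states at the ends of the [M = r ^ 2]
blocks, such that the conditional error is at most twice the mean and at most half of the
transitions have probability below [2 ^ -(4 S)]. Given the path, the [X_j] are independent.
The entropy of their partial sums, taken in a large finite group [(Z/N)^n], never decreases
and is at most [n ln N], far less than [M]; hence at some non-rare step the law [q] of the
partial sum is almost unchanged by a shift [x - x'], for most [x, x'] in a set [U] of
Gaussian measure about [2 ^ -(4 S)]. Let [d v] be the L1 distance between [q] and its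
translate by [v]: a subadditive function, tiny on [U - U].

Since the Gaussian is almost invariant under short shifts, disjoint translates of [U] cannot
be too many, so at most [2 ^ (4 S)] short vectors are pairwise far apart for [d]. Process the
basis vectors [e_i] in order, adjoining the generators [e_i, K e_i, K ^ 2 e_i, ...] as long as
all subset sums of the generators stay pairwise far apart; at most [4 S] generators arise.
When [K ^ L e_i] is refused, it is [d]-close to a combination of the previous generators with
coefficients [0, 1, -1]. These relations form the rows of a triangular integer matrix [W], with
the row [K ^ (8 Lm) e_i] when the maximal length [Lm] is reached, and the sketch is
[x |-> x W ^-1 mod 1]. Its kernel is the lattice spanned by the rows; the coefficients of a short
vector of the kernel grow by a factor at most [1 + 1 / (K - 2)] per generator, so [K] of order
[2 + S / log r] suffices to make [d] tiny on all short vectors of the kernel.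

Consequently the law of the output hardly changes between inputs with the same sketch: a
decoder may either simulate the algorithm on a representative of the fibre, or pick an output
compatible with all inputs of the fibre on which the error probability is below [1 / 4]. *)

Require Import Defs.
From HB Require Import structures.
From mathcomp Require Import all_boot all_order all_algebra.
From mathcomp Require Import finmap.
From mathcomp Require Import all_classical all_reals all_analysis.
From mathcomp Require Import measurable_realfun ring lra zify.
Import Order.TTheory GRing.Theory Num.Theory.
Import numFieldNormedType.Exports.
Local Open Scope classical_set_scope.
Local Open Scope ring_scope.

Set Implicit Arguments.
Unset Strict Implicit.
Unset Printing Implicit Defensive.

(** * Entropy of sums in a finite abelian group *)

Definition law (R : realType) (T : finType) (p : T -> R) :=
  (forall x, 0 <= p x) /\ \sum_x p x = 1.

Definition conv (R : realType) (G : finZmodType) (nu p : G -> R) (z : G) : R :=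
  \sum_x nu x * p (z - x).

Definition dirac0 (R : realType) (G : finZmodType) (z : G) : R := (z == 0)%:R.

Definition ent (R : realType) (T : finType) (p : T -> R) : R :=
  - \sum_z p z * ln (p z).

Definition shift_dist (R : realType) (G : finZmodType) (p : G -> R) (v : G) : R :=
  \sum_z `|p (z - v) - p z|.

(** An L1 stand-in for the mutual information between a new summand of law [nu] and the new sum: how
    far, on average, fixing the summand moves the law of the sum. *)
Definition spread (R : realType) (G : finZmodType) (nu p : G -> R) : R :=
  \sum_x nu x * \sum_z `|p (z - x) - conv nu p z|.

Section Entropy.
Variables (R : realType).

Lemma law_dirac0 (G : finZmodType) : law (@dirac0 R G).
Proof.
split=> [x|]; first exact: ler0n.
by rewrite (bigD1 0) //= big1 ?addr0 /dirac0 ?eqxx // => z /negPf->.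
Qed.

Lemma sum_shift (G : finZmodType) (p : G -> R) x : \sum_z p (z - x) = \sum_z p z.
Proof. by rewrite [RHS](reindex_inj (addIr (- x))). Qed.

Lemma law_conv (G : finZmodType) (nu p : G -> R) : law nu -> law p -> law (conv nu p).
Proof.
move=> [nu0 nu1] [p0 p1]; split=> [z|]; first by apply: sumr_ge0 => x _; exact: mulr_ge0.
rewrite exchange_big -nu1 /=; apply: eq_bigr => x _.
by rewrite -mulr_sumr sum_shift p1 mulr1.
Qed.

(* With [s = sqrt a], [t = sqrt b]: [a ln (a / b) - a + b >= (s - t) ^ 2] since
   [ln x <= x - 1] at [x = t / s], and [|a - b| = |s - t| (s + t)]. *)
Lemma abs_sub_le_kl (k a b : R) : 0 < k -> 0 <= a -> 0 <= b -> (b = 0 -> a = 0) ->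
  `|a - b| <= k / 2 * (a * ln a - a * ln b - a + b) + (a + b) / k.
Proof.
move=> k0 a0 b0 ab.
have [s [s0 sa]] : exists s, 0 <= s /\ a = s ^+ 2.
  by exists (Num.sqrt a); rewrite sqrtr_ge0 sqr_sqrtr.
have [t [t0 tb]] : exists s, 0 <= s /\ b = s ^+ 2.
  by exists (Num.sqrt b); rewrite sqrtr_ge0 sqr_sqrtr.
have kl : (s - t) ^+ 2 <= a * ln a - a * ln b - a + b.
  have [a_0|an0] := eqVneq a 0.
    have s_0 : s = 0 by apply/eqP; rewrite -sqrf_eq0 -sa a_0.
    by rewrite a_0 s_0 tb; lra.
  have sn0 : 0 < s by rewrite lt_neqAle s0 andbT eq_sym -sqrf_eq0 -sa.
  have tn0 : 0 < t.
    rewrite lt_neqAle t0 andbT eq_sym -sqrf_eq0 -tb.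
    by apply: contra an0 => /eqP/ab/eqP.
  have lnst : ln t - ln s <= t / s - 1.
    rewrite -ln_div ?posrE //.
    have := @le_ln1Dx R (t / s - 1); rewrite addrCA subrr addr0; apply.
    by rewrite ltrBrDr addNr divr_gt0.
  rewrite sa tb !lnXn // -[ln s *+ 2]mulr_natl -[ln t *+ 2]mulr_natl.
  have := ler_wpM2l (sqr_ge0 s) lnst.
  have -> : s ^+ 2 * (t / s - 1) = s * t - s ^+ 2 by field; rewrite gt_eqF.
  by move=> h; nra.
(* Arithmetic-geometric mean with free weight [k]: the bound stays linear in the divergence and can
   be summed without a square root. *)
have le1 : `|a - b| <= k / 2 * (s - t) ^+ 2 + (s + t) ^+ 2 / (2 * k).
  have -> : a - b = (s - t) * (s + t) by rewrite sa tb; ring.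
  rewrite normrM (ger0_norm (addr_ge0 s0 t0)).
  rewrite -[(s - t) ^+ 2]real_normK ?num_real //.
  rewrite -subr_ge0.
  have -> : k / 2 * `|s - t| ^+ 2 + (s + t) ^+ 2 / (2 * k) - `|s - t| * (s + t)
     = (k * `|s - t| - (s + t)) ^+ 2 / (2 * k) by field; rewrite gt_eqF.
  by rewrite divr_ge0 ?sqr_ge0 // mulr_ge0 // ltW.
apply: le_trans le1 _; apply: lerD.
  by rewrite ler_wpM2l // divr_ge0 // ltW.
rewrite ler_pdivlMr // sa tb.
have -> : (s + t) ^+ 2 / (2 * k) * k = (s + t) ^+ 2 / 2 by field; rewrite gt_eqF.
by have := sqr_ge0 (s - t); nra.
Qed.

Lemma spread_ge0 (G : finZmodType) (nu p : G -> R) : law nu -> 0 <= spread nu p.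
Proof.
move=> [nu0 _]; apply: sumr_ge0 => x _; apply: mulr_ge0 => //.
by apply: sumr_ge0 => z _.
Qed.

(** Averaging the pointwise bound over [x] and summing over [z], the divergences of the translates
    of [p] from the mixture add up to exactly the entropy gain, because translation preserves
    entropy; the remaining terms total [2 / k]. *)
Lemma spread_le_ent (G : finZmodType) (nu p : G -> R) (k : R) :
  law nu -> law p -> 0 < k ->
  spread nu p <= k / 2 * (ent (conv nu p) - ent p) + 2 / k.
Proof.
move=> lnu lp k0; have [q0 q1] := law_conv lnu lp.
case: (lnu) (lp) => nu0 nu1 [p0 p1]; set q := conv nu p in q0 q1 *.
have -> : k / 2 * (ent q - ent p) + 2 / k = \sum_x nu x * \sum_z
    (k / 2 * (p (z - x) * ln (p (z - x)) - p (z - x) * ln (q z) - p (z - x) + q z)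
     + (p (z - x) + q z) / k).
  have inner x : \sum_z
    (k / 2 * (p (z - x) * ln (p (z - x)) - p (z - x) * ln (q z) - p (z - x) + q z)
     + (p (z - x) + q z) / k)
     = k / 2 * (- ent p - \sum_z p (z - x) * ln (q z)) + 2 / k.
    rewrite big_split /= -mulr_sumr -mulr_suml !big_split /= q1 !sumrN.
    rewrite (sum_shift p) (sum_shift (fun y => p y * ln (p y))) p1 /ent opprK.
    by congr (_ * _ + _); ring.
  under eq_bigr do rewrite inner mulrDr [_ * (k / 2 * _)]mulrCA mulrBr.
  rewrite big_split /= -mulr_suml nu1 mul1r -mulr_sumr.
  congr (_ * _ + _).
  rewrite big_split /= -mulr_suml nu1 mul1r sumrN addrC; congr (_ + _).
  rewrite /ent; congr (- _).
  transitivity (\sum_z \sum_x nu x * p (z - x) * ln (q z)).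
    by apply: eq_bigr => z _; rewrite -mulr_suml.
  rewrite exchange_big /=; apply: eq_bigr => x _.
  by rewrite mulr_sumr; apply: eq_bigr => z _; rewrite mulrA.
apply: ler_sum => x _.
(* Terms with [nu x = 0] are dropped first: [q z = 0] forces [p (z - x) = 0] only for [x] of
   positive weight. *)
have [->|nux] := eqVneq (nu x) 0; first by rewrite !mul0r.
apply: ler_wpM2l => //; apply: ler_sum => z _.
apply: abs_sub_le_kl => // qz0; apply/eqP; apply: contraTT isT => pn0.
have : nu x * p (z - x) <= q z.
  rewrite /q /conv (bigD1 x) //= lerDl; apply: sumr_ge0 => y _; exact: mulr_ge0.
by rewrite /q qz0 leNgt mulr_gt0 // lt_neqAle eq_sym ?nux ?pn0 /=.
Qed.

(** Gibbs' inequality against the uniform law: [ln t <= t - 1] at [t = N^-1 / p x], where the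
    corrections [N^-1 - p x] sum to zero. *)
Lemma ent_le_ln_card (T : finType) (p : T -> R) : law p -> ent p <= ln #|T|%:R.
Proof.
move=> [p0 p1].
have N0 : 0 < #|T|%:R :> R.
  rewrite ltr0n; case: (posnP #|T|) => // /card0_eq T0.
  move: p1; rewrite big_pred0 => [/eqP|x]; last by have := T0 x.
  by rewrite eq_sym oner_eq0.
set N : R := #|T|%:R in N0 *.
have -> : ln N = \sum_x (p x * ln N + (N^-1 - p x)).
  rewrite big_split -mulr_suml p1 mul1r sumrB p1 sumr_const /=.
  by rewrite -[N^-1 *+ _]mulr_natl -/N divff ?gt_eqF // subrr addr0.
rewrite /ent -sumrN; apply: ler_sum => x _.
have [->|px0] := eqVneq (p x) 0.
  by rewrite !mul0r oppr0 add0r addr0 invr_ge0 ltW.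
have px : 0 < p x by rewrite lt_neqAle eq_sym px0 p0.
have : ln (N^-1 / p x) <= N^-1 / p x - 1.
  have := @le_ln1Dx R (N^-1 / p x - 1); rewrite addrCA subrr addr0; apply.
  by rewrite ltrBrDr addNr !divr_gt0 // invr_gt0.
rewrite ln_div ?posrE ?invr_gt0 // lnV ?posrE // => /(ler_wpM2l (p0 x)).
have -> : p x * (N^-1 / p x - 1) = N^-1 - p x by field; rewrite ?gt_eqF.
by move=> h; nra.
Qed.

(** The head of the list is the summand added last, so the partial sums are the suffixes of [l];
    along a stream these are sums of final blocks. *)
Fixpoint convs (G : finZmodType) (l : seq (G -> R)) : G -> R :=
  if l is nu :: l' then conv nu (convs l') else @dirac0 R G.

Lemma law_convs (G : finZmodType) (l : seq (G -> R)) :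
  (forall nu, List.In nu l -> law nu) -> law (convs l).
Proof.
elim: l => [_|nu l IH h] /=; first exact: law_dirac0.
by apply: law_conv; [apply: h; left | apply: IH => x hx; apply: h; right].
Qed.

Lemma ent_dirac0 (G : finZmodType) : ent (@dirac0 R G) = 0.
Proof.
rewrite /ent big1 ?oppr0 // => z _; rewrite /dirac0.
by case: (z == 0); rewrite ?ln1 ?mulr0 ?mul0r.
Qed.

Fixpoint spreads (G : finZmodType) (l : seq (G -> R)) : seq R :=
  if l is nu :: l' then spread nu (convs l') :: spreads l' else [::].

(* The entropy of a partial sum only increases, up to [ln #|G|]; the total spread is
   controlled by the total increase. *)
Lemma sum_spreads_le (G : finZmodType) (l : seq (G -> R)) (k : R) :
  (forall nu, List.In nu l -> law nu) -> 0 < k ->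
  \sum_(a <- spreads l) a <= k / 2 * ln #|G|%:R + 2 / k * (size l)%:R.
Proof.
move=> hl k0.
suff h : \sum_(a <- spreads l) a <= k / 2 * ent (convs l) + 2 / k * (size l)%:R.
  apply: le_trans h _; rewrite lerD2r ler_wpM2l ?divr_ge0 ?(ltW k0) //.
  by apply: ent_le_ln_card; apply: law_convs.
elim: l hl => [_|nu l IH hl] /=; first by rewrite big_nil ent_dirac0 !mulr0 addr0.
have lnu : law nu by apply: hl; left.
have ll : forall x, List.In x l -> law x by move=> x hx; apply: hl; right.
rewrite big_cons.
have := spread_le_ent lnu (law_convs ll) k0; have := IH ll.
rewrite -(addn1 (size l)) natrD => h1 h2.
set a := k / 2 in h1 h2 *; set b := 2 / k in h1 h2 *.
by rewrite !mulrDr mulr1; nra.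
Qed.

(** Convolution averages translates, and averaging never increases an L1 distance. *)
Lemma shift_dist_conv (G : finZmodType) (nu p : G -> R) v :
  law nu -> shift_dist (conv nu p) v <= shift_dist p v.
Proof.
move=> [nu0 nu1].
have -> : shift_dist p v = \sum_x nu x * \sum_z `|p (z - x - v) - p (z - x)|.
  under eq_bigr do rewrite (sum_shift (fun z => `|p (z - v) - p z|)).
  by rewrite -mulr_suml nu1 mul1r.
under eq_bigr do rewrite mulr_sumr.
rewrite exchange_big /=; apply: ler_sum => z _.
rewrite /conv -sumrB; apply: le_trans (ler_norm_sum _ _ _) _.
apply: ler_sum => x _; rewrite -mulrBr normrM ger0_norm //.
by rewrite addrAC.
Qed.

(** Carries the near invariance of one partial sum to the law of the whole sum. *)
Lemma shift_dist_cat (G : finZmodType) (l1 l2 : seq (G -> R)) v :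
  (forall nu, List.In nu l1 -> law nu) ->
  shift_dist (convs (l1 ++ l2)) v <= shift_dist (convs l2) v.
Proof.
elim: l1 => //= nu l IH h.
apply: le_trans (shift_dist_conv _ _ _) _; first by apply: h; left.
by apply: IH => x hx; apply: h; right.
Qed.

Lemma shift_dist0 (G : finZmodType) (p : G -> R) : shift_dist p 0 = 0.
Proof. by rewrite /shift_dist big1 // => z _; rewrite subr0 subrr normr0. Qed.

Lemma shift_distN (G : finZmodType) (p : G -> R) v : shift_dist p (- v) = shift_dist p v.
Proof.
rewrite /shift_dist -(sum_shift _ v); apply: eq_bigr => z _.
by rewrite opprK subrK distrC.
Qed.

Lemma shift_distD (G : finZmodType) (p : G -> R) v w :
  shift_dist p (v + w) <= shift_dist p v + shift_dist p w.
Proof.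
rewrite /shift_dist -(sum_shift (fun z => `|p (z - v) - p z|) w) -big_split /=; apply: ler_sum => z _.
rewrite (addrC v) opprD addrA.
by apply: le_trans (ler_normD _ _); rewrite addrA subrK.
Qed.

(* Both translates are close to the mixture [conv nu p]. *)
Lemma shift_distB_le (G : finZmodType) (p q : G -> R) x y :
  shift_dist p (x - y) <= \sum_z `|p (z - x) - q z| + \sum_z `|p (z - y) - q z|.
Proof.
rewrite /shift_dist -(sum_shift (fun z => `|p (z - (x - y)) - p z|) y) -big_split /=; apply: ler_sum => z _.
have -> : z - y - (x - y) = z - x by rewrite opprB addrA subrK.
rewrite (distrC (p (z - y))).
by apply: le_trans (ler_normD _ _); rewrite addrA subrK.
Qed.

End Entropy.

(** * Conditioning on a path of memory states *)

Lemma In_nseq (A : Type) m (x y : A) : List.In x (nseq m y) -> x = y.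
Proof. by elim: m => //= m IH [|/IH]. Qed.

Section Paths.
Variables (R : realType) (T state : finType).

(** Expectation of [F] at independent samples; a list of laws lets every factor have its own, as
    happens after conditioning. *)
Fixpoint lexpect (l : seq (T -> R)) (F : seq T -> R) : R :=
  if l is nu :: l' then lexpect l' (fun t => \sum_x nu x * F (x :: t)) else F [::].

Lemma lexpect_ge0 (l : seq (T -> R)) F :
  (forall nu, List.In nu l -> law nu) -> (forall t, 0 <= F t) -> 0 <= lexpect l F.
Proof.
elim: l F => [|nu l IH] F hl F0 //=; apply: IH => [x hx|t]; first by apply: hl; right.
have [nu0 _] := hl nu (or_introl erefl).
by apply: sumr_ge0 => x _; exact: mulr_ge0.
Qed.

Variables (gamma : T -> R) (tr : state -> T -> state).
Hypothesis law_gamma : law gamma.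

Definition step_prob (a b : state) : R := \sum_(x | tr a x == b) gamma x.

(** The law of one block conditioned on leading from [a] to [b]. It is the zero function when
    [step_prob a b = 0], whence the notion of positive path. *)
Definition step_law (a b : state) (x : T) : R :=
  if tr a x == b then gamma x / step_prob a b else 0.

Fixpoint path_laws (a : state) (s : seq state) : seq (T -> R) :=
  if s is b :: s' then step_law a b :: path_laws b s' else [::].

Fixpoint positive_path (a : state) (s : seq state) : Prop :=
  if s is b :: s' then 0 < step_prob a b /\ positive_path b s' else True.

Fixpoint rare_steps (theta : R) (a : state) (s : seq state) : nat :=
  if s is b :: s' then ((step_prob a b < theta)%R + rare_steps theta b s')%N else 0%N.

Lemma step_prob_ge0 a b : 0 <= step_prob a b.
Proof. by apply: sumr_ge0 => x _; case: law_gamma. Qed.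

Lemma sum_step_prob a : \sum_b step_prob a b = 1.
Proof. by case: law_gamma => _ <-; rewrite (partition_big (tr a) xpredT). Qed.

Lemma law_step a b : 0 < step_prob a b -> law (step_law a b).
Proof.
move=> ab; split=> [x|].
  by rewrite /step_law; case: ifP => // _; rewrite divr_ge0 ?(ltW ab) //; case: law_gamma.
rewrite /step_law -big_mkcond /= -mulr_suml divff // gt_eqF //.
Qed.

Lemma law_path_laws a s : positive_path a s ->
  forall nu, List.In nu (path_laws a s) -> law nu.
Proof.
elim: s a => //= b s IH a [ab bs] nu [<-|]; first exact: law_step.
exact: IH.
Qed.

Lemma size_path_laws a s : size (path_laws a s) = size s.
Proof. by elim: s a => //= b s IH a; rewrite IH. Qed.

(** Total expectation over the next state. A transition of probability zero contributes nothing on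
    either side, since [gamma] vanishes on its fibre. *)
Lemma step_decomp a (h : T -> R) :
  \sum_x gamma x * h x = \sum_b step_prob a b * \sum_x step_law a b x * h x.
Proof.
rewrite (partition_big (tr a) xpredT) //=; apply: eq_bigr => b _.
have [g0 _] := law_gamma.
rewrite mulr_sumr big_mkcond /=; apply: eq_bigr => x _; rewrite /step_law.
case: eqP => [tb|_]; last by rewrite mul0r mulr0.
have [p0|p0] := eqVneq (step_prob a b) 0; last first.
  by rewrite mulrA mulrCA divff // mulr1.
rewrite p0 mul0r; suff -> : gamma x = 0 by rewrite mul0r.
apply/eqP; rewrite eq_le g0 andbT -p0 /step_prob (bigD1 x) ?tb //= lerDl.
by apply: sumr_ge0.
Qed.

Lemma lexpect_sum (l : seq (T -> R)) (B : finType) (c : B -> R) (F : B -> seq T -> R) :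
  lexpect l (fun t => \sum_b c b * F b t) = \sum_b c b * lexpect l (F b).
Proof.
elim: l F => //= nu l IH F; rewrite -IH; congr (lexpect l _); apply/funext => t.
under eq_bigr do rewrite mulr_sumr.
rewrite exchange_big /=; apply: eq_bigr => b _.
by rewrite mulr_sumr; apply: eq_bigr => x _; rewrite mulrCA.
Qed.

Lemma lexpect_step a m (F : seq T -> R) :
  lexpect (nseq m.+1 gamma) F =
  \sum_b step_prob a b * lexpect (nseq m gamma) (fun t => \sum_x step_law a b x * F (x :: t)).
Proof.
rewrite /= -lexpect_sum; congr (lexpect _ _); apply/funext => t.
exact: step_decomp.
Qed.

Lemma step_law_ge0 a b x : 0 <= step_law a b x.
Proof.
rewrite /step_law; case: ifP => // _.
by rewrite divr_ge0 ?step_prob_ge0 //; case: law_gamma.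
Qed.

(* Averaged over the next state, the conditional error plus [lam] times the number of rare
   steps grows by at most [lam * beta], so some successor does no worse. *)
Lemma choose_path (lam theta beta : R) a m (F : seq T -> R) :
  0 <= lam -> (forall a, \sum_(b | step_prob a b < theta) step_prob a b <= beta) ->
  exists s, [/\ size s = m, positive_path a s &
    lexpect (path_laws a s) F + lam * (rare_steps theta a s)%:R <=
    lexpect (nseq m gamma) F + lam * (m%:R * beta)].
Proof.
move=> lam0 hb; elim: m a F => [|m IH] a F.
  by exists [::]; split=> //=; rewrite mul0r.
pose E b := lexpect (nseq m gamma) (fun t => \sum_x step_law a b x * F (x :: t)).
pose c b := E b + lam * (step_prob a b < theta)%R%:R.
have tot : \sum_b step_prob a b * c b <= lexpect (nseq m.+1 gamma) F + lam * beta.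
  rewrite (lexpect_step a) /c; under eq_bigr do rewrite mulrDr.
  rewrite big_split /= lerD2l; under eq_bigr do rewrite mulrCA.
  rewrite -mulr_sumr ler_wpM2l //; apply: le_trans (hb a).
  rewrite [leRHS]big_mkcond /=; apply: ler_sum => b _.
  by case: ifP; rewrite ?mulr1 ?mulr0.
have [b ab cb] : exists2 b, 0 < step_prob a b &
    c b <= lexpect (nseq m.+1 gamma) F + lam * beta.
  apply: contrapT => hno.
  set C := lexpect _ _ + _ in tot hno.
  have : \sum_b step_prob a b * c b > \sum_b step_prob a b * C; last first.
    by rewrite -mulr_suml sum_step_prob mul1r ltNge tot.
  have cC b : 0 < step_prob a b -> C < c b.
    by move=> ab; rewrite ltNge; apply/negP => cb; apply: hno; exists b.
  have [b0 b0p] : exists b, 0 < step_prob a b.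
    apply: contrapT => h; have := sum_step_prob a; rewrite big1 => [/eqP|b _].
      by rewrite eq_sym oner_eq0.
    apply/eqP; rewrite eq_le step_prob_ge0 andbT leNgt; apply/negP => hb'.
    by apply: h; exists b.
  rewrite [ltLHS](bigD1 b0) //= [ltRHS](bigD1 b0) //=.
  apply: ltr_leD; first by rewrite ltr_pM2l // cC.
  apply: ler_sum => b _; have := step_prob_ge0 a b; rewrite le_eqVlt.
  move=> /predU1P[<-|bp]; first by rewrite !mul0r.
  by rewrite ler_pM2l // ltW // cC.
have [s [ss ps hs]] := IH b (fun t => \sum_x step_law a b x * F (x :: t)).
exists (b :: s); split=> //=; first by rewrite ss.
move: hs cb; rewrite /c -/(E b) natrD -[m.+1%:R]natr1 mulrDl mul1r !mulrDr /=.
by move=> *; lra.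
Qed.

(** Serves the case [delta <= 0], where the weight [4 * delta / m] is not positive: a nonnegative
    [F] of mean zero also has mean zero along each positive path. *)
Lemma lexpect_path_le0 a m s (F : seq T -> R) : (forall t, 0 <= F t) ->
  lexpect (nseq m gamma) F <= 0 -> size s = m -> positive_path a s ->
  lexpect (path_laws a s) F <= 0.
Proof.
move=> + + sm; rewrite -{m}sm; elim: s a F => [|b s IH] a F F0 //= h [ab ps].
have F'0 b' t : 0 <= \sum_x step_law a b' x * F (x :: t).
  by apply: sumr_ge0 => x _; rewrite mulr_ge0 // step_law_ge0.
apply: IH => //; move: h; rewrite -[lexpect _ _]/(lexpect (nseq (size s).+1 gamma) F) (lexpect_step a).
have E0 b' : 0 <= lexpect (nseq (size s) gamma) (fun t => \sum_x step_law a b' x * F (x :: t)).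
  by apply: lexpect_ge0 => // nu h'; rewrite (In_nseq h').
rewrite (bigD1 b) //= => h; rewrite -(ler_pM2l ab) mulr0; apply: le_trans h.
by rewrite lerDl; apply: sumr_ge0 => b' _; rewrite mulr_ge0 ?step_prob_ge0.
Qed.

(** With [beta = 1/8] and [lam = 4 * delta / m] the penalty term is [delta / 2]. The chosen path
    then has error at most [3/2 * delta] and at most [3/8 * m] rare steps. *)
Lemma good_path a m (F : seq T -> R) (delta theta : R) : (0 < m)%N ->
  (forall t, 0 <= F t) -> lexpect (nseq m gamma) F <= delta ->
  (forall a, \sum_(b | step_prob a b < theta) step_prob a b <= 8^-1) ->
  exists s, [/\ size s = m, positive_path a s, lexpect (path_laws a s) F <= 2 * delta &
    (2 * rare_steps theta a s <= m)%N].
Proof.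
move=> m0 F0 hF hb; have mR : 0 < m%:R :> R by rewrite ltr0n.
have E0 : 0 <= lexpect (nseq m gamma) F by apply: lexpect_ge0 => // nu h'; rewrite (In_nseq h').
have CE0 s : positive_path a s -> 0 <= lexpect (path_laws a s) F.
  by move=> ps; apply: lexpect_ge0 => //; exact: law_path_laws ps.
have [d0|d0] := ltrP 0 delta; last first.
  have [s [ss ps hs]] := choose_path a m F ler01 hb.
  have le0 : lexpect (nseq m gamma) F <= 0 by exact: le_trans hF d0.
  have c0 := lexpect_path_le0 F0 le0 ss ps.
  exists s; split=> //; first by lra.
  rewrite -(ler_nat R) natrM; have := CE0 s ps; move: hs; rewrite !mul1r; lra.
pose lam := 4 * delta / m%:R.
have lam0 : 0 < lam by rewrite divr_gt0 // mulr_gt0.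
have [s [ss ps hs]] := choose_path a m F (ltW lam0) hb.
have lm : lam * (m%:R / 8) = delta / 2 by rewrite /lam; field; rewrite gt_eqF.
rewrite lm in hs; exists s; split=> //.
  have : 0 <= lam * (rare_steps theta a s)%:R by rewrite mulr_ge0 // ltW.
  by lra.
rewrite -(ler_nat R) natrM -(ler_pM2l lam0).
have -> : lam * m%:R = 4 * delta by rewrite /lam; field; rewrite gt_eqF.
by have := CE0 s ps; lra.
Qed.

(** There are at most [2 ^ S] successors, so the rare ones weigh at most [2 ^ -(3 S) <= 1/8] if
    [S > 0]. If [S = 0] the only transition has probability one and is not rare. *)
Lemma rare_sum_le (S : nat) a : (#|state| <= 2 ^ S)%N ->
  \sum_(b | step_prob a b < 2^-1 ^+ (4 * S)) step_prob a b <= 8^-1.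
Proof.
case: S => [|S] cS.
  rewrite big1 ?invr_ge0 // => b; rewrite muln0 expr0 => pb.
  have := sum_step_prob a; rewrite (bigD1 b) //= big1 ?addr0; first by move: pb => /[swap] ->; rewrite ltxx.
  move=> c cb; exfalso; move: cS; rewrite expn0 leqNgt => /negP; apply.
  by rewrite (cardD1 b) (cardD1 c) !inE cb.
apply: (@le_trans _ _ (\sum_(b : state) 2^-1 ^+ (4 * S.+1))).
  rewrite big_mkcond /=; apply: ler_sum => b _; case: ifP => [/ltW//|_].
  by rewrite exprn_ge0 // invr_ge0.
rewrite sumr_const -[leLHS]mulr_natl.
apply: (@le_trans _ _ ((2 ^+ S.+1) * 2^-1 ^+ (4 * S.+1))).
  by rewrite ler_wpM2r ?exprn_ge0 ?invr_ge0 // -natrX ler_nat.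
have -> : (4 * S.+1 = S.+1 + (3 + 3 * S))%N by lia.
rewrite 2!exprD mulrA -exprMn divff // expr1n mul1r.
have -> : 8^-1 = 2^-1 ^+ 3 :> R by field.
by rewrite ler_piMr ?exprn_ge0 ?invr_ge0 // exprn_ile1 ?invr_ge0 // invf_le1 ?ler1n.
Qed.

(* Under the conditional laws of a path, the samples follow that path almost surely. *)
Lemma eq_lexpect_path a s (F F' : seq T -> R) :
  (forall t, scanl tr a t = s -> F t = F' t) ->
  lexpect (path_laws a s) F = lexpect (path_laws a s) F'.
Proof.
elim: s a F F' => [|b s IH] a F F' FF' /=; first exact: FF'.
apply: IH => t ht; apply: eq_bigr => x _; rewrite /step_law.
by case: eqP => [xb|_]; rewrite ?mul0r // FF' //= xb ht.
Qed.

End Paths.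

(** * Images of the path laws in a finite group *)

Section PushForward.
Variables (R : realType) (T : finType) (G : finZmodType) (pi : T -> G).

Definition push (nu : T -> R) (z : G) : R := \sum_(x | pi x == z) nu x.

Lemma sum_push nu (h : G -> R) : \sum_z push nu z * h z = \sum_x nu x * h (pi x).
Proof.
rewrite [RHS](partition_big pi xpredT) //=; apply: eq_bigr => z _.
by rewrite mulr_suml; apply: eq_bigr => x /eqP->.
Qed.

Lemma law_push nu : law nu -> law (push nu).
Proof.
move=> [nu0 nu1]; split=> [z|]; first exact: sumr_ge0.
have := sum_push nu (fun=> 1); under eq_bigr do rewrite mulr1.
by under [RHS]eq_bigr do rewrite mulr1; rewrite nu1.
Qed.

(** For functions of the sum alone, an expectation along a path becomes one over [G], where the
    entropy bound applies. *)
Lemma lexpect_convs (l : seq (T -> R)) (phi : G -> R) :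
  lexpect l (fun t => phi (\sum_(x <- t) pi x)) =
  \sum_z convs (map push l) z * phi z.
Proof.
elim: l phi => [|nu l IH] phi /=.
  rewrite big_nil (bigD1 0) //= /dirac0 eqxx mul1r big1 ?addr0 // => z /negPf->.
  by rewrite mul0r.
transitivity (lexpect l (fun t => (fun z => \sum_x nu x * phi (pi x + z)) (\sum_(x <- t) pi x))).
  by congr lexpect; apply/funext => t; apply: eq_bigr => x _; rewrite big_cons.
rewrite (IH (fun z => \sum_x nu x * phi (pi x + z))) /conv; under [RHS]eq_bigr do rewrite mulr_suml.
rewrite [RHS]exchange_big /=; under eq_bigr do rewrite mulr_sumr.
rewrite exchange_big /=.
under [RHS]eq_bigr => y _ do under eq_bigr => z _ do rewrite -mulrA.
under [RHS]eq_bigr do rewrite -mulr_sumr.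
rewrite [RHS](sum_push nu (fun y => \sum_z convs (map push l) (z - y) * phi z)).
apply: eq_bigr => x _; rewrite mulr_sumr.
rewrite [in RHS](reindex_inj (addrI (pi x))) /=.
by apply: eq_bigr => z _; rewrite addrAC subrr add0r mulrCA.
Qed.

Lemma spread_push nu (p : G -> R) :
  spread (push nu) p = \sum_x nu x * \sum_z `|p (z - pi x) - conv (push nu) p z|.
Proof. by rewrite /spread sum_push. Qed.

End PushForward.

(** * A step whose summand barely moves the partial sum *)

Section GoodStep.
Variables (R : realType) (T state : finType) (G : finZmodType) (pi : T -> G).
Variables (gamma : T -> R) (tr : state -> T -> state).
Hypothesis law_gamma : law gamma.

Let plaws a s := map (push pi) (path_laws gamma tr a s).

Lemma law_plaws a s : positive_path gamma tr a s ->
  forall nu, List.In nu (plaws a s) -> law nu.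
Proof.
move=> ps nu; rewrite /plaws => h.
have : exists2 mu, nu = push pi mu & List.In mu (path_laws gamma tr a s).
  elim: (path_laws _ _ _ _) h => //= mu l IH [<-|/IH[mu' e i]]; first by exists mu => //; left.
  by exists mu' => //; right.
by move=> [mu -> /(law_path_laws law_gamma ps)]; exact: law_push.
Qed.

(** Every non-rare step is charged [c]; a rare step only has nonnegative spread, and the last term
    makes up for it. *)
Lemma spreads_ge (c theta : R) a s : positive_path gamma tr a s ->
  (forall s1 b s2, s = s1 ++ b :: s2 -> theta <= step_prob gamma tr (last a s1) b ->
     c <= spread (push pi (step_law gamma tr (last a s1) b)) (convs (plaws b s2))) ->
  0 <= c ->
  c * (size s)%:R <=
    \sum_(x <- spreads (plaws a s)) x + c * (rare_steps gamma tr theta a s)%:R.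
Proof.
move=> + + c0; elim: s a => [|b s IH] a /=; first by rewrite big_nil !mulr0 addr0.
move=> [ab ps] hc; rewrite big_cons.
have {}IH := IH b ps (fun s1 b' s2 e => hc (b :: s1) b' s2 (congr1 (cons b) e)).
have h0 : 0 <= spread (push pi (step_law gamma tr a b)) (convs (plaws b s)).
  by apply: spread_ge0; apply: law_push; exact: law_step.
have h1 := hc [::] b s erefl; rewrite -/(plaws b s).
rewrite -[(size s).+1%:R]natr1 natrD !mulrDr mulr1.
case: ltP h1 => [_ _|_ /(_ isT) h1] /=; last by lra.
by rewrite mulr1; lra.
Qed.

(* Most steps are not rare, and the total spread is at most [k/2 ln #|G| + 2 M / k]. *)
Lemma good_step (c theta k : R) a s : positive_path gamma tr a s -> 0 <= c -> 0 < k ->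
  (2 * rare_steps gamma tr theta a s <= size s)%N ->
  k / 2 * ln #|G|%:R + 2 / k * (size s)%:R < c / 2 * (size s)%:R ->
  exists s1 b s2, [/\ s = s1 ++ b :: s2, theta <= step_prob gamma tr (last a s1) b,
     0 < step_prob gamma tr (last a s1) b &
     spread (push pi (step_law gamma tr (last a s1) b)) (convs (plaws b s2)) <= c].
Proof.
move=> ps c0 k0 rs hc.
have pos s1 b s2 : s = s1 ++ b :: s2 -> 0 < step_prob gamma tr (last a s1) b.
  by move=> e; move: ps; rewrite e; elim: (s1) (a) => [|b1 s1' IH] a' /= [] // _ /IH.
apply: contrapT => hno.
have hge : c * (size s)%:R <=
    \sum_(x <- spreads (plaws a s)) x + c * (rare_steps gamma tr theta a s)%:R.
  apply: spreads_ge => // s1 b s2 e hb; rewrite leNgt; apply/negP => /ltW hs.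
  by apply: hno; exists s1, b, s2; split=> //; exact: pos e.
have := sum_spreads_le (law_plaws ps) k0; rewrite size_map size_path_laws => h.
have : c * (2 * rare_steps gamma tr theta a s)%:R <= c * (size s)%:R.
  by rewrite ler_wpM2l // ler_nat.
by rewrite natrM mulrCA; move: hge h hc; lra.
Qed.

(** Markov's inequality: at most a tenth of [nu] lies where the distance to the mixture exceeds ten
    times its mean bound. *)
Lemma close_mass (nu : T -> R) (p : G -> R) (c : R) : law nu -> 0 < c ->
  spread (push pi nu) p <= c ->
  9 / 10 <= \sum_(x | \sum_z `|p (z - pi x) - conv (push pi nu) p z| <= 10 * c) nu x.
Proof.
move=> [nu0 nu1] c0; rewrite spread_push.
pose f x := \sum_z `|p (z - pi x) - conv (push pi nu) p z|.
rewrite -/f => hs.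
have f0 x : 0 <= f x by apply: sumr_ge0.
have : \sum_(x | ~~ (f x <= 10 * c)) nu x <= 1 / 10.
  rewrite ler_pdivlMr // -(ler_pM2l c0) mulr1; apply: le_trans hs.
  rewrite mulrCA mulr_suml [leLHS]big_mkcond /=; apply: ler_sum => x _.
  case: ifPn => [|_]; last exact: mulr_ge0 (nu0 x) (f0 x).
  by rewrite -ltNge => /ltW h; rewrite ler_wpM2l // mulrC.
have e : 1 = \sum_(x | f x <= 10 * c) nu x + \sum_(x | ~~ (f x <= 10 * c)) nu x.
  by rewrite -nu1; exact: bigID.
move=> h.
by move: e h; rewrite /f; lra.
Qed.

End GoodStep.

(* Translates of a set [U] by separated vectors are disjoint, and an almost translation
   invariant weight of finite mass bounds their number. *)
Lemma packing_bound (R : realType) (V : zmodType) (T : finType) (val : T -> V)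
    (w : V -> R) (Z theta : R) (S : nat) (U : pred T) (vs : seq V) :
  injective val -> (forall v, 0 <= w v) ->
  (forall s, uniq s -> \sum_(v <- s) w v <= Z) ->
  99 / 100 * Z <= \sum_x w (val x) -> 0 < \sum_x w (val x) ->
  theta = 2^-1 ^+ (4 * S) ->
  9 / 10 * theta * (\sum_x w (val x)) <= \sum_(x | U x) w (val x) ->
  (forall v x, v \in vs -> 95 / 100 * w (val x) <= w (val x + v)) ->
  uniq vs ->
  (forall v v' x x', v \in vs -> v' \in vs -> U x -> U x' ->
     val x + v = val x' + v' -> v = v') ->
  (size vs < 2 ^ (4 * S).+1)%N.
Proof.
move=> val_inj w0 hZ hball; set W := \sum_x w (val x) in hball * => W0 th hU hw uvs hdis.
pose s := [seq val x + v | v <- vs, x <- enum U].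
(* Disjointness of the translates, as uniqueness of the list of all sums. *)
have us : uniq s.
  apply: allpairs_uniq => //; first exact: enum_uniq.
  move=> [v x] [v' x'] /allpairsP[[v1 x1] [/= hv1 hx1 [-> ->]]].
  move=> /allpairsP[[v2 x2] [/= hv2 hx2 [-> ->]]] /= e.
  rewrite !mem_enum in hx1 hx2.
  have ev := hdis _ _ _ _ hv1 hv2 hx1 hx2 e.
  by move: e; rewrite ev => /addIr/val_inj->.
have := hZ s us; rewrite /s big_allpairs_dep /=.
have : (size vs)%:R * (95 / 100 * (9 / 10 * theta * W)) <=
    \sum_(v <- vs) \sum_(x <- enum U) w (val x + v).
  rewrite -sum1_size natr_sum mulr_suml big_seq [leRHS]big_seq; apply: ler_sum => v vvs.
  rewrite mul1r big_enum /=.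
  apply: (@le_trans _ _ (95 / 100 * \sum_(x | U x) w (val x))); first by rewrite ler_wpM2l.
  by rewrite mulr_sumr; apply: ler_sum => x _; exact: hw.
(* As [Z <= W / 0.99], the number of translates is at most [1 / (0.99 * 0.95 * 0.9 * theta) < 2 /
   theta]. *)
move=> h1 h2; rewrite -(ltr_nat R) natrX exprS.
have th0 : 0 < theta by rewrite th exprn_gt0 // invr_gt0.
have -> : 2 ^+ (4 * S) = theta^-1 by rewrite th exprVn invrK.
rewrite ltr_pdivlMr // -(ltr_pM2r W0).
by move: hball h1 h2; move: (\sum_(v <- vs) _) ((size vs)%:R) W0 => X N W0; nra.
Qed.

(** * Finitely supported laws and seeds *)

Lemma esum_supported (R : realType) (B : finType) (U : choiceType) (h : B -> U)
    (a : U -> \bar R) :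
  injective h -> (forall u, (0 <= a u)%E) -> (forall u, a u != 0%E -> exists b, u = h b) ->
  \esum_(u in [set: U]) a u = (\sum_b a (h b))%E.
Proof.
move=> hI a0 ah.
transitivity (\esum_(u in range h) a u).
  rewrite [RHS]esum_mkcond; apply: eq_esum => u _; case: ifPn => // hu.
  apply/eqP; apply: contraNT hu => /ah[b ->].
  by rewrite inE; exists b.
rewrite (reindex_esum [set: B] (range h) h) //; last first.
  by split=> [x _|x y _ _ /hI //|_ [x] _ <-]; exists x.
rewrite esum_fset ?fsbig_finite; try exact: finite_finset; last by [].
apply: perm_big; apply: uniq_perm; rewrite ?fset_uniq ?index_enum_uniq // => b.
by rewrite in_fset_set ?mem_index_enum; [rewrite in_setT|exact: finite_finset].
Qed.

Lemma esum_EFin_supported (R : realType) (B : finType) (U : choiceType) (h : B -> U)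
    (a : U -> R) :
  injective h -> (forall u, 0 <= a u) -> (forall u, a u != 0 -> exists b, u = h b) ->
  \esum_(u in [set: U]) (a u)%:E = (\sum_b a (h b))%:E.
Proof.
move=> hI a0 ah; rewrite -sumEFin; exact: esum_supported.
Qed.

(** Only finitely many success patterns [pat w] occur; a realised pattern of maximal weight bounds
    the integrand, and hence its mean over the seeds. *)
Lemma choose_seed (R : realType) (d : measure_display) (W : measurableType d)
    (P : probability W R) (B : finType) (c : B -> R) (V : B -> set W) (x : R) :
  (forall b, 0 <= c b) -> (forall b, measurable (V b)) ->
  (x%:E <= \sum_b (c b)%:E * P (V b))%E ->
  exists w, x <= \sum_(b | w \in V b) c b.
Proof.
move=> c0 mV hx.
pose pat (w : W) : {set B} := [set b | w \in V b]%SET.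
have [w0 _] : exists w0 : W, True.
  apply: contrapT => h; have := @probability_setT _ _ _ P.
  have -> : [set: W] = set0 by rewrite -subset0 => w _; apply: h; exists w.
  by rewrite measure0 => -[/esym/eqP]; rewrite oner_eq0.
have [s /asboolP[w <-] hmax] := @arg_maxP _ _ _ (pat w0) (fun s => `[< exists w, pat w = s >])
   (fun s : {set B} => \sum_(b in s) c b) (asboolT (ex_intro _ w0 erefl)).
have patE w' : \sum_(b in pat w') c b = \sum_(b | w' \in V b) c b.
  by apply: eq_bigl => b; rewrite inE.
exists w; rewrite -lee_fin; apply: le_trans hx _.
have -> : (\sum_b (c b)%:E * P (V b) =
   \int[P]_(w in [set: W]) (\sum_b (c b)%:E * (\1_(V b) w)%:E))%E.
  rewrite ge0_integral_sum //=; last 2 first.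
  - move=> b; apply: measurable_funeM; apply/measurable_EFinP; exact: measurable_indic.
  - by move=> b w' _; rewrite mule_ge0 // lee_fin.
  apply: eq_bigr => b _; rewrite ge0_integralZl //.
  - by rewrite integral_indic // setIT.
  - by apply/measurable_EFinP; exact: measurable_indic.
  - by rewrite lee_fin.
apply: (@le_trans _ _ (\int[P]_(w' in [set: W]) cst (\sum_(b | w \in V b) c b)%:E w')%E); last first.
  by rewrite integral_cst // [X in (_ * X)%E]probability_setT mule1.
apply: ge0_le_integral => //.
- by move=> w' _; apply: sume_ge0 => b _; rewrite mule_ge0 // lee_fin.
- apply: emeasurable_sum => b; apply: measurable_funeM; apply/measurable_EFinP; exact: measurable_indic.
move=> w' _; rewrite -patE; under eq_bigr do rewrite -EFinM.
rewrite sumEFin lee_fin; have := hmax (pat w') (asboolT (ex_intro _ w' erefl)).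
rewrite /= patE => h; apply: le_trans h; rewrite [leRHS]big_mkcond /=; apply: ler_sum => b _.
by rewrite indicE; case: (w' \in V b); rewrite ?mulr1 ?mulr0.
Qed.

Lemma sum_ffun_lexpect (R : realType) (T : finType) (gamma : T -> R) M (F : seq T -> R) :
  \sum_(x : {ffun 'I_M -> T}) (\prod_j gamma (x j)) * F [seq x j | j <- enum 'I_M] =
  lexpect (nseq M gamma) F.
Proof.
elim: M F => [|M IH] F.
  rewrite (bigD1 (ffun0 (card_ord 0))) //= big_ord0 [X in _ + X]big1 ?addr0 => [|x].
    by rewrite mul1r; congr F; apply: size0nil; rewrite size_map size_enum_ord.
  by move=> /eqP[]; apply/ffunP => -[].
pose e (p : T * {ffun 'I_M -> T}) : {ffun 'I_M.+1 -> T} :=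
  [ffun j => if unlift ord0 j is Some j' then p.2 j' else p.1].
pose e' (x : {ffun 'I_M.+1 -> T}) := (x ord0, [ffun j => x (lift ord0 j)]).
have ee' : cancel e e'.
  move=> [a x]; rewrite /e' /e ffunE unlift_none /=; congr (_, _).
  by apply/ffunP => j; rewrite !ffunE liftK.
have e'e : cancel e' e.
  move=> x; apply/ffunP => j; rewrite ffunE /=; case: unliftP => [j' ->|->] //.
  by rewrite ffunE.
rewrite (reindex e) /=; last by exists e' => x _; [exact: ee' | exact: e'e].
rewrite -(pair_big xpredT xpredT (fun a x => (\prod_j gamma (e (a, x) j)) *
   F [seq e (a, x) j | j <- enum 'I_M.+1])) /= exchange_big /= -IH.
apply: eq_bigr => x _; rewrite mulr_sumr; apply: eq_bigr => a _.
rewrite big_ord_recl ffunE unlift_none /= mulrCA mulrA; congr (_ * _ * F _).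
  by apply: eq_bigr => j _; rewrite ffunE liftK.
rewrite enum_ordSl /= ffunE unlift_none /= -map_comp; congr cons.
by apply: eq_map => j /=; rewrite ffunE liftK.
Qed.

Lemma finite_box n (m : nat) : finite_set [set v : 'rV[int]_n | forall i, `|v 0 i| <= m%:Z].
Proof.
pose f (u : 'rV['I_(2 * m).+1]_n) : 'rV[int]_n := \row_i ((u 0 i : nat)%:Z - m%:Z).
apply: (@sub_finite_set _ _ (range f)); last exact/finite_image/finite_finset.
move=> v hv; pose a i : int := v 0 i + m%:Z; exists (\row_i inord `|a i|%N) => //.
apply/rowP => i; rewrite !mxE inordK /a; have := hv i; lia.
Qed.

Section Norm.
Variables (R : realType) (n : nat).

Lemma coord_le_l2norm (v : 'rV[int]_n) i : `|(v 0 i)%:~R| <= l2norm v :> R.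
Proof.
rewrite /l2norm -(sqrtr_sqr (v 0 i)%:~R) ler_wsqrtr // (bigD1 i) //= lerDl.
by apply: sumr_ge0 => k _; exact: sqr_ge0.
Qed.

Lemma l2norm_ge0 (v : 'rV[int]_n) : 0 <= l2norm v :> R.
Proof. exact: sqrtr_ge0. Qed.

Lemma finite_l2ball (x : 'rV[int]_n) (rho : R) : finite_set [set v | l2norm (v - x) <= rho].
Proof.
pose m := (Num.trunc rho).+1.
apply: (@sub_finite_set _ _ ((fun v => v + x) @` [set v : 'rV[int]_n | forall i, `|v 0 i| <= m%:Z])).
  move=> v /= hv; exists (v - x); last by rewrite subrK.
  move=> i; have := le_trans (coord_le_l2norm (v - x) i) hv.
  move=> /le_lt_trans/(_ (truncnS_gt rho)) /ltW.
  by rewrite -intr_norm -[_%:R]/(m%:Z%:~R) ler_int.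
exact/finite_image/finite_box.
Qed.

End Norm.

(** * The triangular lattice and its sketch *)

Section Greedy.
Variables (n K Lm : nat) (near : pred 'rV[int]_n).
Hypothesis near_opp : forall v, near (- v) = near v.

(* Satisfied by the differences of two numbers with at most [L] digits [0], [1] in base [K]. *)
Definition digits_bound (L : nat) (x : int) := (K%:Z - 1) * `|x| + 1 <= K%:Z ^+ L.

(** The shape of a refused generator [K ^ L i * e_i] minus a difference of two subset sums of the
    generators present. *)
Definition triangular_row (L : 'I_n -> nat) (i : 'I_n) (w : 'rV[int]_n) :=
  [/\ forall k : 'I_n, (i < k)%N -> w 0 k = 0,
      forall k : 'I_n, (k < i)%N -> digits_bound (L k) (w 0 k) &
      digits_bound (L i) (w 0 i - K%:Z ^+ L i)].

(** [V] stands for the subset sums of the generators [K ^ l * e_j] with [l < L j]: a number with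
    [L j] digits [0], [1] in base [K] is at most [(K ^ L j - 1) / (K - 1)]. *)
Definition separated (L : 'I_n -> nat) (V : seq 'rV[int]_n) :=
  [/\ size V = (2 ^ (\sum_i L i))%N, pairwise (fun v v' => ~~ near (v - v')) V,
      forall v, v \in V -> forall j, 0 <= v 0 j /\ (K%:Z - 1) * v 0 j + 1 <= K%:Z ^+ L j
    & forall i, (L i <= Lm)%N].

Definition resolved (L : 'I_n -> nat) (i : 'I_n) :=
  L i = Lm \/ exists2 w, near w & triangular_row L i w.

Let digits_diff (L : nat) (a b : int) : (1 < K)%N -> 0 <= a -> 0 <= b ->
  (K%:Z - 1) * a + 1 <= K%:Z ^+ L -> (K%:Z - 1) * b + 1 <= K%:Z ^+ L ->
  digits_bound L (a - b).
Proof.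
move=> K1 a0 b0; rewrite /digits_bound; set X := K%:Z ^+ L => ha hb.
by have [ab|ba] := lerP a b; nia.
Qed.

Let digits_diff0 (a : int) : (1 < K)%N -> 0 <= a -> (K%:Z - 1) * a + 1 <= K%:Z ^+ 0 -> a = 0.
Proof. by rewrite expr0 => K1 a0 h; nia. Qed.

(** If the next power of [K] in direction [i] is near a difference of elements of [V], that relation
    is the row sought. Otherwise [V] and its translate by [f] are together separated, which doubles
    [V] and raises [L i]; this stops at [Lm]. *)
Lemma extend_separated (i : 'I_n) (L : 'I_n -> nat) (V : seq 'rV[int]_n) :
  (1 < K)%N -> separated L V -> (forall k : 'I_n, (i < k)%N -> L k = 0%N) ->
  exists (L' : 'I_n -> nat) (V' : seq 'rV[int]_n),
    [/\ separated L' V', (forall k, k != i -> L' k = L k) & resolved L' i].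
Proof.
move=> K1; move: {-2}(Lm - L i)%N (erefl (Lm - L i)%N) => fuel.
elim: fuel L V => [|fuel IH] L V hf sepV L0.
  exists L, V; split=> //; left; case: sepV => _ _ _ /(_ i); lia.
case: (sepV) => szV sV bV LV.
pose f : 'rV[int]_n := K%:Z ^+ L i *: delta_mx 0 i.
have fE k : f 0 k = if k == i then K%:Z ^+ L i else 0.
  by rewrite /f !mxE eqxx /=; case: (k == i); rewrite ?mulr1 ?mulr0.
have [/hasP[v vV /hasP[v' v'V nvv]]|hno] :=
  boolP (has (fun v => has (fun v' => near (f - (v - v'))) V) V).
  exists L, V; split=> //; right; exists (f - (v - v')) => //.
  have bd k := bV _ vV k; have bd' k := bV _ v'V k.
  have E k : (f - (v - v')) 0 k = f 0 k + (v' 0 k - v 0 k) by rewrite !mxE opprB.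
  split=> [k ik|k ki|]; rewrite E fE.
  (* Directions after [i] have no generator yet, so both vectors vanish there and the row is
     triangular. *)
  - rewrite gt_eqF //; have := bd k; have := bd' k; rewrite (L0 k ik).
    by move=> [/digits_diff0 h /h->] // [/digits_diff0 h' /h'->] //.
  - rewrite lt_eqF // add0r; have [? ?] := bd k; have [? ?] := bd' k.
    exact: digits_diff.
  - rewrite eqxx addrAC subrr add0r; have [? ?] := bd i; have [? ?] := bd' i.
    exact: digits_diff.
pose L' k := if k == i then (L i).+1 else L k.
have L'i : L' i = (L i).+1 by rewrite /L' eqxx.
have L'N k : k != i -> L' k = L k by rewrite /L' => /negPf->.
have far v v' : v \in V -> v' \in V -> ~~ near (f - (v - v')).
  move=> vV v'V; apply: contra hno => h.
  by apply/hasP; exists v => //; apply/hasP; exists v'.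
have [] := IH L' (V ++ [seq v + f | v <- V]).
- by rewrite L'i; lia.
- split.
  + rewrite size_cat size_map szV addnn -mul2n -expnS; congr (2 ^ _)%N.
    rewrite (bigD1 i) //= [in RHS](bigD1 i) //= L'i addSn; congr (_ + _).+1.
    by apply: eq_bigr => k /L'N.
  + rewrite pairwise_cat sV /= pairwise_map; apply/andP; split.
      apply/allrelP => v _ vV /mapP[v' v'V ->].
      rewrite -near_opp; have -> : - (v - (v' + f)) = f - (v - v').
        by rewrite !opprD !opprK; apply/rowP => j; rewrite !mxE; ring.
      exact: far.
    apply: sub_pairwise sV => v v'.
    by rewrite /relpre /= opprD addrACA subrr addr0.
  + move=> v; rewrite mem_cat => /orP[vV|/mapP[v' v'V ->]] j.
      have [v0 vb] := bV _ vV j; split=> //; apply: le_trans vb _.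
      have [->|/L'N->//] := eqVneq j i.
      by rewrite L'i exprS ler_peMl ?exprn_ge0 //; lia.
    have [v0 vb] := bV _ v'V j; rewrite mxE fE.
    have [ji|/L'N->] := eqVneq j i; last by rewrite addr0.
    rewrite ji in v0 vb *; rewrite L'i exprS.
    have X0 : 0 <= K%:Z ^+ L i by exact: exprn_ge0.
    split; first exact: addr_ge0.
    rewrite (_ : K%:Z * _ = (K%:Z - 1) * K%:Z ^+ L i + K%:Z ^+ L i); last by ring.
    by rewrite mulrDr addrAC addrC lerD2l.
  + by move=> k; rewrite /L'; case: eqP => _; [lia | exact: LV].
- by move=> k ik; rewrite L'N ?L0 // gt_eqF.
move=> L'' [V'' [sep'' hL'' res]]; exists L'', V''; split=> // k ki.
by rewrite hL'' // L'N.
Qed.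

(** A row depends on [L] only up to its own index, so it survives the processing of later
    directions. *)
Lemma triangular_row_ext (L L' : 'I_n -> nat) (i : 'I_n) w :
  (forall k : 'I_n, (k <= i)%N -> L' k = L k) ->
  triangular_row L i w -> triangular_row L' i w.
Proof.
move=> LL [h1 h2 h3]; split=> // [k ki|]; first by rewrite LL ?(ltnW ki) //; exact: h2.
by rewrite LL.
Qed.

Lemma greedy_basis : (1 < K)%N ->
  exists (L : 'I_n -> nat) (V : seq 'rV[int]_n),
    separated L V /\ forall i, resolved L i.
Proof.
move=> K1.
suff h m : (m <= n)%N -> exists (L : 'I_n -> nat) (V : seq 'rV[int]_n),
    [/\ separated L V, forall i : 'I_n, (i < m)%N -> resolved L i
      & forall i : 'I_n, (m <= i)%N -> L i = 0%N].
  by have [L [V [? h2 _]]] := h n (leqnn n); exists L, V; split=> // i; exact: h2.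
elim: m => [_|m IH mn].
  exists (fun=> 0%N), [:: 0]; split=> //; split=> //.
    by rewrite big1.
  by move=> v; rewrite inE => /eqP-> j; rewrite mxE mulr0 expr0.
have [L [V [sep res L0]]] := IH (ltnW mn).
have [|L' [V' [sep' LL' res']]] := @extend_separated (Ordinal mn) L V K1 sep.
  by move=> k /= mk; rewrite L0 // ltnW.
exists L', V'; split=> // i.
- rewrite ltnS leq_eqVlt => /predU1P[im|im].
    by rewrite (_ : i = Ordinal mn) //; exact: val_inj.
  have LLi (k : 'I_n) : (k <= i)%N -> L' k = L k.
    by move=> ki; rewrite LL' // neq_ltn /= (leq_ltn_trans ki im).
  case: (res i im) => [E|[w nw hw]]; [left; rewrite LLi //|right].
  by exists w => //; exact: triangular_row_ext hw.
- by move=> mi; rewrite LL' ?L0 // ?(ltnW mi) // neq_ltn /= mi orbT.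
Qed.

End Greedy.

(** * The sketch attached to a triangular lattice *)

Section TriangularSketch.
Variables (R : realType) (n : nat) (W : 'M[int]_n) (H : {set 'I_n}).
Hypothesis W_trig : forall i k : 'I_n, (i < k)%N -> W i k = 0.
Hypothesis W_diag : forall i, 0 < W i i.
Hypothesis W_col : forall i k, i \notin H -> W k i = (k == i)%:R.

Let Wr : 'M[R]_n := map_mx intr W.

Let Wr_unit : Wr \in unitmx.
Proof.
rewrite unitmxE det_trig ?unitfE.
  by apply/prodf_neq0 => i _; rewrite mxE intr_eq0 gt_eqF.
by apply/is_trig_mxP => i k ik; rewrite mxE W_trig.
Qed.

Definition lattice_coord (x : 'rV[int]_n) (i : 'I_n) : R :=
  (map_mx intr x *m invmx Wr) 0 i.

(** Outside [H] the columns of [W] are unit columns, so those coordinates are integers and vanish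
    modulo 1. Keeping only [H] makes the dimension independent of [n]. *)
Definition triangular_sketch_fun (x : 'rV[int]_n) : sketch_group R #|H| 0 :=
  (\row_l \pi_(circle R)%qT (lattice_coord x (enum_val l)), 0).

Lemma lattice_coordB x y i : lattice_coord (x - y) i = lattice_coord x i - lattice_coord y i.
Proof. by rewrite /lattice_coord map_mxB mulmxBl !mxE. Qed.

Lemma triangular_sketch_additive : zmod_morphism triangular_sketch_fun.
Proof.
move=> x y; rewrite /triangular_sketch_fun; congr (_, _); last by rewrite subr0.
by apply/rowP => l; rewrite !mxE lattice_coordB; exact: raddfB.
Qed.

HB.instance Definition _ :=
  GRing.isZmodMorphism.Build _ _ triangular_sketch_fun triangular_sketch_additive.

Definition triangular_sketch : linear_sketch R n #|H| 0 := triangular_sketch_fun.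

Lemma lattice_coord_mul (z : 'rV[int]_n) i : lattice_coord (z *m W) i = (z 0 i)%:~R.
Proof. by rewrite /lattice_coord map_mxM -mulmxA mulmxV // mulmx1 mxE. Qed.

Lemma lattice_coordK (x : 'rV[int]_n) i :
  \sum_k lattice_coord x k * (W k i)%:~R = (x 0 i)%:~R.
Proof.
have /rowP/(_ i) := mulmxKV Wr_unit (map_mx intr x).
by rewrite mxE [in RHS]mxE => <-; apply: eq_bigr => k _; rewrite [Wr _ _]mxE.
Qed.

Lemma triangular_sketch_eq (x x' : 'rV[int]_n) :
  triangular_sketch x = triangular_sketch x' <-> exists z, x - x' = z *m W.
Proof.
split=> [[/rowP eA]|[z xz]]; last first.
  congr (_, _); apply/rowP => l; rewrite !mxE; apply/eq_circle.
  by rewrite -lattice_coordB xz lattice_coord_mul intr_int.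
have yint i : lattice_coord (x - x') i \is a Num.int.
  have [iH|iH] := boolP (i \in H).
    have := eA (enum_rank_in iH i); rewrite !mxE enum_rankK_in // => /eq_circle.
    by rewrite lattice_coordB.
  have := lattice_coordK (x - x') i; rewrite (bigD1 i) //= big1 => [|k ki].
    by rewrite W_col // eqxx mulr1 addr0 => ->; exact: intr_int.
  by rewrite W_col // (negPf ki) mulr0.
exists (\row_i Num.floor (lattice_coord (x - x') i)).
apply/rowP => i; apply: (@intr_inj R); rewrite -lattice_coordK [in RHS]mxE rmorph_sum.
by apply: eq_bigr => k _ /=; rewrite mxE rmorphM /= floorK.
Qed.

(** Euclidean division from the last coordinate down: subtracting a multiple of row [k] does not
    disturb the coordinates after [k]. *)
Lemma box_representative (x : 'rV[int]_n) :
  exists z : 'rV[int]_n, forall i, 0 <= (x - z *m W) 0 i < W i i.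
Proof.
suff h m : (m <= n)%N -> exists z : 'rV[int]_n,
    forall i : 'I_n, (n - m <= i)%N -> 0 <= (x - z *m W) 0 i < W i i.
  by have [z hz] := h n (leqnn n); exists z => i; apply: hz; rewrite subnn.
elim: m => [_|m IH mn]; first by exists 0 => i; rewrite subn0 leqNgt ltn_ord.
have [z hz] := IH (ltnW mn).
have kn : (n - m.+1 < n)%N by rewrite ltn_subrL (leq_ltn_trans _ mn).
pose k := Ordinal kn; pose a := (x - z *m W) 0 k; pose q := (a %/ W k k)%Z.
exists (z + q *: delta_mx 0 k) => i ki.
have -> : (x - (z + q *: delta_mx 0 k) *m W) 0 i = (x - z *m W) 0 i - q * W k i.
  by rewrite mulmxDl opprD addrA -scalemxAl -rowE !mxE.
have [->|nik] := eqVneq i k.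
  have Wk := W_diag k; have -> : (x - z *m W) 0 k - q * W k k = (a %% W k k)%Z.
    by rewrite /q {1}/modz.
  by rewrite modz_ge0 ?gt_eqF //= ltz_pmod.
have ik : (k < i)%N by rewrite ltn_neqAle eq_sym nik.
rewrite W_trig // mulr0 subr0; apply: hz.
by move: ik => /=; lia.
Qed.

(** Each class modulo the lattice meets the box with sides [W i i], so the image is no larger than
    the determinant. *)
Lemma triangular_sketch_range :
  finite_set (range triangular_sketch) /\
  (#|` fset_set (range triangular_sketch)| <= \prod_i `|W i i|)%N.
Proof.
pose T := {dffun forall i : 'I_n, 'I_(`|W i i|%N)}.
pose F (t : T) := triangular_sketch (\row_i (t i : nat)%:Z).
have sub : range triangular_sketch `<=` [set` [fset F t | t in T]%fset].
  move=> _ [x _ <-] /=; have [z hz] := box_representative x.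
  pose a i := (x - z *m W) 0 i.
  have lt i : (`|a i| < `|W i i|)%N.
    by have := hz i; have := W_diag i; rewrite -/(a i); lia.
  apply/imfsetP; exists [ffun i => Ordinal (lt i)] => //=.
  rewrite /F; apply/triangular_sketch_eq; exists z.
  apply/rowP => i; rewrite [LHS]mxE [X in _ + X]mxE [X in _ - X]mxE ffunE /=.
  by have /andP[h _] := hz i; rewrite gez0_abs // /a !mxE opprB addrC subrK.
have fin : finite_set (range triangular_sketch).
  by apply: sub_finite_set sub _; exact: finite_fset.
split=> //; apply: leq_trans (_ : (#|` [fset F t | t in T]%fset| <= _)%N).
  apply: fsubset_leq_card; apply/fsubsetP => a.
  by rewrite in_fset_set // inE => /sub.
apply: leq_trans (leq_imfset_card _ _ _) _.
rewrite /= -cardE card_dep_ffun foldrE big_image /=.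
by under eq_bigr do rewrite card_ord.
Qed.

End TriangularSketch.

Lemma PoszX (k m : nat) : (k ^ m)%N%:Z = k%:Z ^+ m.
Proof. by elim: m => // m IH; rewrite expnS PoszM IH exprS. Qed.

(** * Smallness of the seminorm on short lattice vectors *)

Section QuotientSketch.
Variables (R : realType) (n K Lm t h0 : nat) (d : 'rV[int]_n -> R) (eps g B : R).
Hypothesis d0 : d 0 = 0.
Hypothesis dN : forall v, d (- v) = d v.
Hypothesis dD : forall v w, d (v + w) <= d v + d w.
Hypotheses (eps_ge0 : 0 <= eps) (g_ge1 : 1 <= g) (B_ge0 : 0 <= B).
Hypotheses (K_gt2 : (2 < K)%N) (Lm_gt0 : (0 < Lm)%N).
Hypothesis h0_ge : (minn t n <= h0)%N.
Hypothesis growth : (1 + (K%:R - 2)^-1) ^+ h0 <= g.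
Hypothesis room : B + K%:R ^+ Lm * (B * g) < K%:R ^+ (8 * Lm).
Hypothesis packing : forall V : seq 'rV[int]_n,
  pairwise (fun v v' => ~~ (d (v - v') <= eps)) V ->
  (forall v, v \in V -> forall j, 0 <= v 0 j <= K%:Z ^+ Lm) ->
  (size V < 2 ^ t.+1)%N.

Definition l1norm (x : 'rV[int]_n) : R := \sum_i `|(x 0 i)%:~R|.

Lemma seminorm_sum (T : finType) (F : T -> 'rV[int]_n) :
  d (\sum_i F i) <= \sum_i d (F i).
Proof.
elim/big_rec2: _ => [|i y x _ h]; first by rewrite d0.
by apply: le_trans (dD _ _) _; rewrite lerD2l.
Qed.

Lemma seminorm_scale (z : int) v : d (z *: v) <= `|z%:~R| * d v.
Proof.
have nat_scale (m : nat) : d (m%:Z *: v) <= m%:R * d v.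
  elim: m => [|m IH]; first by rewrite scale0r d0 mul0r.
  rewrite (_ : Posz m.+1 = m%:Z + 1) ?scalerDl ?scale1r; last by lia.
  rewrite (_ : m.+1%:R = m%:R + 1 :> R) ?mulrDl ?mul1r; last by rewrite -addn1 natrD.
  by apply: le_trans (dD _ _) _; rewrite lerD2r.
case: z => m; first by rewrite -pmulrn normr_nat.
by rewrite NegzE mulrNz normrN -pmulrn normr_nat scaleNr dN.
Qed.

(** A discrete Gronwall argument from the last index down; only indices in [H] multiply the tail by
    [1 + b], hence the exponent. *)
Lemma tail_growth (a x : 'I_n -> R) (H : {set 'I_n}) (b : R) :
  0 <= b -> (forall i, 0 <= x i) -> (forall i, 0 <= a i) ->
  (forall k, a k <= x k + (k \in H)%:R * b * \sum_(i < n | (k < i)%N) a i) ->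
  \sum_i a i <= (\sum_i x i) * (1 + b) ^+ #|H|.
Proof.
move=> b0 x0 a0 ha.
suff h m : (m <= n)%N -> \sum_(i < n | (n - m <= i)%N) a i <=
    (\sum_(i < n | (n - m <= i)%N) x i) * (1 + b) ^+ #|[set i in H | (n - m <= i)%N]|.
  have := h n (leqnn n); rewrite subnn.
  rewrite (_ : [set i in H | _] = H); last by apply/setP => i; rewrite inE andbT.
  by [].
have b1 : 1 <= 1 + b by rewrite lerDl.
elim: m => [|m IH] mn.
  rewrite !big_pred0 ?mul0r // => i; rewrite subn0 leqNgt ltn_ord //.
have kn : (n - m.+1 < n)%N by rewrite ltn_subrL (leq_ltn_trans _ mn).
pose k := Ordinal kn.
have Ek (i : 'I_n) : (n - m.+1 <= i)%N = (i == k) || (n - m <= i)%N.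
  by rewrite -val_eqE /=; lia.
have kE (i : 'I_n) : (k < i)%N = (n - m <= i)%N by rewrite /=; lia.
have split_sum (F : 'I_n -> R) : \sum_(i < n | (n - m.+1 <= i)%N) F i =
    F k + \sum_(i < n | (n - m <= i)%N) F i.
  rewrite (bigD1 k) //=; congr (_ + _); apply: eq_bigl => i.
  by rewrite Ek -val_eqE /=; lia.
rewrite !split_sum; have := ha k; under eq_bigl do rewrite kE.
have {IH} := IH (ltnW mn).
set sa := \sum_(i < n | _) a i; set sx := \sum_(i < n | _) x i.
have sx0 : 0 <= sx by apply: sumr_ge0.
have sa0 : 0 <= sa by apply: sumr_ge0.
set c := #|[set i in H | (n - m <= i)%N]| => IH hk.
have -> : #|[set i in H | (n - m.+1 <= i)%N]| = ((k \in H) + c)%N.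
  have [kH|kH] := boolP (k \in H); last first.
    rewrite add0n; apply: eq_card => i; rewrite !inE Ek.
    by have [->|] := eqVneq i k; rewrite ?(negPf kH).
  rewrite (cardsD1 k) !inE kH leqnn /=; congr (_ + _)%N.
  apply: eq_card => i; rewrite !inE Ek.
  have [->|//] := eqVneq i k; rewrite [RHS]/= leqNgt.
  by rewrite (_ : (_ < _)%N) ?andbF //= -subSn ?subSS ?leq_sub2l.
have X1 : 1 <= (1 + b) ^+ c by rewrite exprn_ege1.
have xk := x0 k.
set X := (1 + b) ^+ c in IH X1 *; case: (k \in H) hk => /=.
  rewrite exprS -/X mul1r => hk.
  apply: (@le_trans _ _ (x k + (1 + b) * sa)); first by lra.
  have h1 : (1 + b) * sa <= (1 + b) * (sx * X) by rewrite ler_wpM2l // addr_ge0.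
  have h2 : x k <= x k * ((1 + b) * X) by rewrite ler_peMr // mulr_ege1.
  by rewrite mulrDl mulrCA in h1 *; lra.
rewrite add0n -/X !mul0r addr0 => hk.
have h2 : x k <= x k * X by rewrite ler_peMr.
by rewrite mulrDl; lra.
Qed.

(** A short kernel vector is [z *m W] with [z] of l1 norm at most [B * g], and each row that really
    occurs has [d] at most [eps]; subadditivity concludes. *)
Theorem quotient_sketch : exists (p : nat) (A : linear_sketch R n p 0),
  [/\ (p <= t)%N, finite_set (range A),
      (#|` fset_set (range A)| <= (2 * K) ^ (8 * t))%N &
      forall x x', A x = A x' -> l1norm (x - x') <= B -> d (x - x') <= B * g * eps].
Proof.
have K1 : (1 < K)%N by rewrite ltnW.
have K0 : (0 < K)%N by rewrite ltnW.
have [|L [V [sepV res]]] := @greedy_basis n K Lm (fun v => d v <= eps) _ K1.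
  by move=> v; rewrite dN.
case: sepV => szV sV bV LLm.
have KX j : 1 <= K%:Z ^+ j by apply: exprn_ege1; lia.
(* The [2 ^ (sum of L)] elements of [V] are separated, so the packing bound limits the number of
   generators. *)
have sumL : (\sum_i L i <= t)%N.
  rewrite -ltnS -(ltn_exp2l _ _ (ltnSn 1)) -szV; apply: packing => // v vV j.
  have [v0 vb] := bV v vV j; rewrite v0 /=.
  have : K%:Z ^+ L j <= K%:Z ^+ Lm by apply: ler_weXn2l; rewrite ?LLm //; lia.
  have h : v 0 j <= (K%:Z - 1) * v 0 j by rewrite ler_peMl //; lia.
  by move=> LmX; apply: le_trans h (le_trans _ (le_trans vb LmX)); rewrite lerDl.
(* A row for a direction of maximal length has no reason to be small for [d]; [Q] is taken so large
   that no short kernel vector involves it. *)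
pose Q := (K ^ (8 * Lm))%N.
have /choice[w hw] i : exists w : 'rV[int]_n,
    (L i = Lm /\ w = Q%:Z *: delta_mx 0 i) \/ (d w <= eps /\ triangular_row K L i w).
  by case: (res i) => [h|[w nw tw]]; [exists (Q%:Z *: delta_mx 0 i); left | exists w; right].
pose W : 'M[int]_n := \matrix_i w i.
have WE i k : W i k = w i 0 k by rewrite mxE.
pose H : {set 'I_n} := [set i | (0 < L i)%N]%SET.
have HE i : (i \in H) = (0 < L i)%N by rewrite inE.
have wfree i k : w i = Q%:Z *: delta_mx 0 i -> w i 0 k = if k == i then Q%:Z else 0.
  by move=> ->; rewrite !mxE eqxx /=; case: (k == i); rewrite ?mulr1 ?mulr0.
have W_trig (i k : 'I_n) : (i < k)%N -> W i k = 0.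
  move=> ik; rewrite WE; case: (hw i) => [[_ /wfree->]|[_ [h _ _]]]; last exact: h.
  by rewrite gt_eqF.
have W_off : forall i k : 'I_n, (k < i)%N -> (K%:Z - 1) * `|W i k| + 1 <= K%:Z ^+ L k.
  move=> i k ki; rewrite WE; case: (hw i) => [[_ /wfree->]|[_ [_ h _]]]; last exact: h.
  by rewrite lt_eqF // normr0 mulr0 add0r.
have QX : K%:Z ^+ Lm <= Q%:Z.
  by rewrite /Q PoszX ler_weXn2l //; lia.
have W_diag_ge i : (K%:Z - 2) * K%:Z ^+ L i + 1 <= (K%:Z - 1) * W i i.
  rewrite WE; case: (hw i) => [[-> /wfree->]|[_ [_ _]]].
    by rewrite eqxx; have := KX Lm; nia.
  by rewrite /digits_bound; have := KX (L i); case: (lerP (w i 0 i) (K%:Z ^+ L i)); nia.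
have W_diag i : 0 < W i i by have := W_diag_ge i; have := KX (L i); nia.
have W_col i k : i \notin H -> W k i = (k == i)%:R.
  rewrite HE -eqn0Ngt => /eqP Li.
  have [->|] := eqVneq k i.
    rewrite WE; case: (hw i) => [[E _]|[_ [_ _]]]; first by move: Lm_gt0; rewrite -E Li.
    rewrite /digits_bound Li expr0 => h; apply/eqP; rewrite -subr_eq0 -normr_eq0.
    by apply/eqP; nia.
  rewrite neq_ltn => /orP[ki|ik]; first exact: W_trig.
  have := W_off _ _ ik; rewrite Li expr0 => h; apply/eqP; rewrite -normr_eq0.
  by apply/eqP; nia.
have W_diag_le i : (`|W i i| <= (2 * K) ^ (8 * L i))%N.
  have [iH|iH] := boolP (i \in H); last first.
    by rewrite W_col // eqxx /= expn_gt0; lia.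
  rewrite HE in iH; rewrite WE; case: (hw i) => [[E /wfree->]|[_ [_ _]]].
    by rewrite eqxx E absz_nat /Q leq_exp2r ?muln_gt0 //; lia.
  rewrite /digits_bound => h.
  have : w i 0 i <= 2 * K%:Z ^+ L i.
    by have := KX (L i); case: (lerP (w i 0 i) (K%:Z ^+ L i)) h; nia.
  have := W_diag i; rewrite WE; set a := w i 0 i => wp w2.
  have : (`|a| <= 2 * K ^ L i)%N.
    by rewrite -lez_nat gtz0_abs // PoszM PoszX.
  move=> /leq_trans; apply; rewrite expnMn.
  apply: leq_mul.
    by rewrite -{1}(expn1 2) leq_exp2l //; lia.
  by rewrite leq_exp2l //; lia.
have cardH : (#|H| <= \sum_i L i)%N.
  rewrite -sum1_card big_mkcond /=; apply: leq_sum => i _.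
  by rewrite HE; case: (L i).
have [fin card_le] := triangular_sketch_range R W_trig W_diag W_col.
exists #|H|, (triangular_sketch R W H); split=> //.
- exact: leq_trans sumL.
- apply: leq_trans card_le _; apply: (@leq_trans (\prod_i (2 * K) ^ (8 * L i))).
    by apply: leq_prod => i _.
  by rewrite -expn_sum -big_distrr /= leq_exp2l ?leq_mul //; lia.
move=> x x' /(triangular_sketch_eq R W_trig W_diag W_col)[z xz] xB.
set v := x - x' in xz xB *.
pose a i : R := `|(z 0 i)%:~R|; pose xr i : R := `|(v 0 i)%:~R|.
pose k1 : R := K%:R - 1; pose k2 : R := K%:R - 2.
have k2_ge1 : 1 <= k2 by rewrite /k2 lerBrDr -(natrD _ 1 2) ler_nat.
have k12 : k1 = k2 + 1 by rewrite /k1 /k2; ring.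
pose X i : R := K%:R ^+ L i.
have XE i : X i = (K%:Z ^+ L i)%:~R by rewrite rmorphXn.
have X1 i : 1 <= X i by apply: exprn_ege1; rewrite ler1n.
have vE k : v 0 k = z 0 k * W k k + \sum_(i < n | (k < i)%N) z 0 i * W i k.
  rewrite xz mxE (bigD1 k) //=; congr (_ + _).
  rewrite [RHS]big_mkcond /= [LHS]big_mkcond /=; apply: eq_bigr => i _.
  have [->|ik] := eqVneq i k; first by rewrite ltnn.
  by case: ltnP => // ki; rewrite W_trig ?mulr0 // ltn_neqAle ik.
pose tail k := \sum_(i < n | (k < i)%N) a i.
have a_ge0 i : 0 <= a i by exact: normr_ge0.
have xr_ge0 i : 0 <= xr i by exact: normr_ge0.
have tail0 k : 0 <= tail k by apply: sumr_ge0 => i _; exact: a_ge0.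
have diagR k : k2 * X k <= k1 * (W k k)%:~R.
  have := W_diag_ge k; rewrite -(ler_int R) rmorphD !rmorphM !rmorphB /= -XE => h.
  by rewrite /k1 /k2; apply: le_trans h; rewrite lerDl.
have offR (i k : 'I_n) : (k < i)%N -> k1 * `|(W i k)%:~R| <= X k.
  move=> ki; have := W_off _ _ ki.
  rewrite -(ler_int R) rmorphD !rmorphM !rmorphB /= -XE intr_norm => h.
  by rewrite /k1; apply: le_trans h; rewrite lerDl.
have Wpos k : 0 < (W k k)%:~R :> R by rewrite ltr0z.
have main k : k1 * (W k k)%:~R * a k <= k1 * xr k + X k * tail k.
  have k10 : 0 <= k1 by lra.
  have -> : k1 * (W k k)%:~R * a k = k1 * `|(v 0 k - \sum_(i < n | (k < i)%N) z 0 i * W i k)%:~R|.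
    by rewrite vE addrK rmorphM normrM (gtr0_norm (Wpos k)) // /a; ring.
  rewrite rmorphB /=.
  apply: le_trans (ler_wpM2l k10 (ler_normB _ _)) _.
  rewrite mulrDr lerD2l rmorph_sum /=.
  apply: le_trans (ler_wpM2l k10 (ler_norm_sum _ _ _)) _.
  rewrite mulr_sumr mulr_sumr; apply: ler_sum => i ki.
  by rewrite rmorphM normrM mulrCA [X k * _]mulrC ler_wpM2l // offR.
(* On [H], off-diagonal entries are at most [1 / (K - 2)] of the diagonal, and [X k >= K] makes the
   factor of [xr k] at most 1. Off [H], [a k = xr k]. *)
have rec k : a k <= xr k + (k \in H)%:R * k2^-1 * tail k.
  have [kH|kH] := boolP (k \in H).
    rewrite mul1r; have m := main k; have dR := diagR k.
    have a0 := a_ge0 k; have x0 := xr_ge0 k.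
    have h : k2 * X k * a k <= k1 * xr k + X k * tail k.
      by apply: le_trans m; rewrite ler_wpM2r.
    have XK : K%:R <= X k.
      rewrite HE in kH; rewrite /X; case: (L k) kH => // j _.
      by rewrite exprS ler_peMr // exprn_ege1 // ler1n.
    have kx : k1 * xr k <= k2 * X k * xr k.
      rewrite ler_wpM2r // k12; apply: le_trans (ler_wpM2l _ XK); last by lra.
      by rewrite (_ : K%:R = k2 + 2); [nra | rewrite /k2; ring].
    have X0 : 0 < X k by exact: lt_le_trans (X1 k).
    have k20 : 0 < k2 by exact: lt_le_trans k2_ge1.
    rewrite -(ler_pM2l (mulr_gt0 k20 X0)).
    rewrite mulrDr.
    have -> : k2 * X k * (k2^-1 * tail k) = X k * tail k by field; rewrite gt_eqF.
    by apply: le_trans h _; rewrite lerD2r.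
  rewrite !mul0r addr0 /a /xr vE W_col // eqxx mulr1 big1 ?addr0 // => i ki.
  by rewrite W_col // -val_eqE gtn_eqF // mulr0.
have total : \sum_i a i <= B * g.
  apply: le_trans (tail_growth (b := k2^-1) (x := xr) (H := H) _ _ _ rec) _ => //.
    by rewrite invr_ge0; lra.
  apply: ler_pM => //; first by apply: sumr_ge0 => i _; exact: xr_ge0.
    by rewrite exprn_ge0 // addr_ge0 // invr_ge0; lra.
  apply: le_trans growth; apply: ler_weXn2l.
    by rewrite lerDl invr_ge0 -/k2; lra.
  apply: leq_trans h0_ge; rewrite leq_min (leq_trans cardH) //=.
  by rewrite -[leqRHS]card_ord max_card.
have tail_le k : tail k <= B * g.
  apply: le_trans total; rewrite /tail [leLHS]big_mkcond /=; apply: ler_sum => i _.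
  by case: ifP.
have vsum : v = \sum_i z 0 i *: w i.
  rewrite xz mulmx_sum_row; apply: eq_bigr => i _; congr (_ *: _).
  by apply/rowP => j; rewrite !mxE.
rewrite vsum; apply: le_trans (seminorm_sum _) _.
apply: (@le_trans _ _ (\sum_i a i * eps)); last first.
  by rewrite -mulr_suml ler_wpM2r.
apply: ler_sum => i _; case: (hw i) => [[E wi]|[dw _]]; last first.
  by apply: le_trans (seminorm_scale _ _) _; rewrite ler_wpM2l.
(* For a row with diagonal entry [Q], a nonzero integer coefficient would give
   [Q <= B + K ^ Lm * (B * g)], against [room]. *)
suff -> : z 0 i = 0 by rewrite scale0r d0 mulr_ge0.
apply/eqP; rewrite -normr_eq0; apply/eqP.
have : a i < 1.
  have Wi : (W i i)%:~R = K%:R ^+ (8 * Lm) :> R.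
    by rewrite WE wfree // eqxx /Q PoszX rmorphXn.
  have := main i; rewrite Wi /X E => m.
  have kk : 1 <= k1 by lra.
  have xi : xr i <= B.
    by apply: le_trans xB; rewrite /l1norm (bigD1 i) //= lerDl sumr_ge0.
  have KLm : 0 <= K%:R ^+ Lm :> R by rewrite exprn_ge0.
  have tg := ler_wpM2l KLm (tail_le i).
  rewrite ltNge; apply/negP => a1.
  have q0 : 0 < K%:R ^+ (8 * Lm) :> R by rewrite exprn_gt0 // ltr0n.
  have : k1 * K%:R ^+ (8 * Lm) <= k1 * (B + K%:R ^+ Lm * (B * g)).
    apply: (@le_trans _ _ (k1 * xr i + K%:R ^+ Lm * tail i)).
      by apply: le_trans m; rewrite ler_peMr // mulr_ge0 ?(ltW q0) //; lra.
    apply: (@le_trans _ _ (k1 * B + K%:R ^+ Lm * (B * g))).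
      by rewrite lerD // ler_wpM2l //; lra.
    by rewrite mulrDr lerD2l ler_peMl // mulr_ge0 // mulr_ge0 // (le_trans ler01 g_ge1).
  by rewrite ler_pM2l ?leNgt ?room //; lra.
rewrite /a -intr_norm (_ : 1 = 1%:~R) // ltr_int; lia.
Qed.

End QuotientSketch.

(** * The simulation for finitely supported data *)

Section ModN.
Variables (n N : nat).
Hypothesis N_gt1 : (1 < N)%N.

(** The entropy bound needs a finite group; [N] will exceed all differences that occur, so reduction
    loses nothing. *)
Definition reduce (v : 'rV[int]_n) : 'rV['Z_N]_n := map_mx intr v.

Lemma reduceB v w : reduce (v - w) = reduce v - reduce w.
Proof. exact: map_mxB. Qed.

Lemma reduceD v w : reduce (v + w) = reduce v + reduce w.
Proof. exact: map_mxD. Qed.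

Lemma reduceN v : reduce (- v) = - reduce v.
Proof. exact: map_mxN. Qed.

Lemma reduce0 : reduce 0 = 0.
Proof. exact: map_mx0. Qed.

Lemma reduce_sum (T : Type) (s : seq T) (F : T -> 'rV[int]_n) :
  reduce (\sum_(x <- s) F x) = \sum_(x <- s) reduce (F x).
Proof. by elim/big_rec2: _ => [|x a b _ <-]; rewrite ?reduce0 ?reduceD. Qed.

Lemma reduce_inj (v w : 'rV[int]_n) : (forall i, `|v 0 i - w 0 i| < N%:Z) -> reduce v = reduce w -> v = w.
Proof.
move=> h e; apply/rowP => i; apply/eqP; rewrite -subr_eq0.
have : ((v 0 i - w 0 i)%:~R : 'Z_N) = 0.
  move/rowP/(_ i): e; rewrite !mxE rmorphB /= => ->; exact: subrr.
move: (h i); set z := v 0 i - w 0 i.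
have nat0 (m : nat) : (m < N)%N -> (m%:R : 'Z_N) = 0 -> m = 0%N.
  by move=> mN /(congr1 (@nat_of_ord _)); rewrite val_Zp_nat //= modn_small.
case: z => m; first by rewrite -pmulrn => mN /nat0->.
rewrite NegzE normrN mulrNz => mN /eqP; rewrite oppr_eq0 -pmulrn => /eqP /nat0.
by move=> /(_ mN).
Qed.

Lemma card_modN : #|'rV['Z_N]_n| = (N ^ n)%N.
Proof. by rewrite card_mx mul1n card_ord Zp_cast. Qed.

End ModN.

Lemma In_catl (A : Type) (x : A) s t : List.In x s -> List.In x (s ++ t).
Proof. by elim: s => //= y s IH [|/IH]; [left | right]. Qed.

Lemma dist_lt_mod (a b p q : int) (e m N : nat) : `|a - b| <= e%:Z -> `|p| <= m%:Z ->
  `|q| <= m%:Z -> (e + 2 * m < N)%N -> `|(a - p) - (b - q)| < N%:Z.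
Proof. lia. Qed.

(** * The simulation along one path of memory states *)

Section FiniteCore.
Variables (R : realType) (n : nat) (O : Type) (rel : 'rV[int]_n -> O -> Prop).
Variables (a : det_alg n O) (S M N K Lm h0 : nat).
Variables (T Y : finType) (val : T -> 'rV[int]_n) (vy : Y -> 'rV[int]_n).
Variables (gamma : T -> R) (I : Y -> R) (delta c k g B : R) (dy mx : nat).
Hypothesis law_gamma : law gamma.
Hypothesis law_I : law I.
Hypothesis card_state : (#|state a| <= 2 ^ S)%N.
Hypothesis M_gt0 : (0 < M)%N.

Definition fails (y : 'rV[int]_n) (o : O) : R := (`[< ~ rel y o >])%:R.

Hypothesis err : \sum_y I y * \sum_(x : {ffun 'I_M -> T}) (\prod_j gamma (x j)) *
  fails (vy y) (run a (exact_stream (vy y) [ffun j => val (x j)])) <= delta.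
Hypothesis coord_y : forall y y' i, `|vy y 0 i - vy y' 0 i| <= dy%:Z.
Hypothesis coord_x : forall x i, `|val x 0 i| <= mx%:Z.
Hypothesis N_large : (dy + 2 * (M * mx) < N)%N.
Hypothesis N_gt1 : (1 < N)%N.
Hypothesis diam_y : forall y y', l1norm R (vy y - vy y') <= B.
Hypotheses (k_gt0 : 0 < k) (c_gt0 : 0 < c) (g_ge1 : 1 <= g) (B_ge0 : 0 <= B).
Hypothesis c_large : k / 2 * ln (N ^ n)%:R + 2 / k * M%:R < c / 2 * M%:R.
Hypotheses (K_gt2 : (2 < K)%N) (Lm_gt0 : (0 < Lm)%N).
Hypothesis h0_ge : (minn (4 * S) n <= h0)%N.
Hypothesis growth : (1 + (K%:R - 2)^-1) ^+ h0 <= g.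
Hypothesis room : B + K%:R ^+ Lm * (B * g) < K%:R ^+ (8 * Lm).
Hypothesis packing : forall (U : pred T) (vs : seq 'rV[int]_n),
  9 / 10 * 2^-1 ^+ (4 * S) <= \sum_(x | U x) gamma x ->
  (forall v, v \in vs -> forall j, 0 <= v 0 j <= K%:Z ^+ Lm) -> uniq vs ->
  (forall v v' x x', v \in vs -> v' \in vs -> U x -> U x' ->
     val x + v = val x' + v' -> v = v') ->
  (size vs < 2 ^ (4 * S).+1)%N.

Let tr (s : state a) (x : T) : state a := foldl (@step _ _ a) s (can (val x)).

Let foldl_stream (s : state a) (t : seq T) (l : seq (update n)) :
  foldl (@step _ _ a) s (flatten [seq can (val x) | x <- t] ++ l) =
  foldl (@step _ _ a) (foldl tr s t) l.
Proof. by elim: t s => //= x t IH s; rewrite -catA foldl_cat IH. Qed.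

Let F (t : seq T) : R := \sum_y I y *
  fails (vy y) (answer (foldl (@step _ _ a) (foldl tr (start a) t)
                              (can (vy y - \sum_(x <- t) val x)))).

Let fails_ge0 y o : 0 <= fails y o.
Proof. exact: ler0n. Qed.

Let F_ge0 t : 0 <= F t.
Proof. by apply: sumr_ge0 => y _; rewrite mulr_ge0 ?fails_ge0 //; case: law_I. Qed.

Let mean_F : lexpect (nseq M gamma) F <= delta.
Proof.
apply: le_trans err; rewrite -sum_ffun_lexpect.
under [leRHS]eq_bigr do rewrite mulr_sumr.
rewrite [leRHS]exchange_big /=; apply: ler_sum => x _.
rewrite /F mulr_sumr; apply: ler_sum => y _; rewrite mulrCA ler_wpM2l //; first by case: law_I.
rewrite /run /exact_stream.
rewrite (eq_map (g := fun j => can (val (x j)))); last by move=> j; rewrite ffunE.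
rewrite (map_comp (fun t => can (val t)) x) foldl_stream big_map big_enum /=.
by under [X in _ <= _ * fails _ (answer (foldl _ _ (can (_ - X))))]eq_bigr do rewrite ffunE.
Qed.

(** Given the path, the memory before the last block is fixed, so the output depends only on
    [vy y - \sum_(x <- t) val x]. [P] is the law of its residue modulo [N], and [out] runs the
    algorithm on the vector recovered from the residue. *)
Theorem finite_core : exists (p : nat) (A : linear_sketch R n p 0),
  [/\ (p <= 4 * S)%N, finite_set (range A),
      (#|` fset_set (range A)| <= (2 * K) ^ (8 * (4 * S)))%N &
      exists (C : finType) (P : 'rV[int]_n -> C -> R) (out : C -> O),
        [/\ forall y, law (P y),
            \sum_y I y * \sum_b P (vy y) b * fails (vy y) (out b) <= 2 * delta &
            forall y y', A (vy y) = A (vy y') ->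
              \sum_b `|P (vy y) b - P (vy y') b| <= B * g * (20 * c)]].
Proof.
have [s [sM ps Es rs]] := good_path (tr := tr) law_gamma (start a) M_gt0 F_ge0 mean_F
  (fun a' => rare_sum_le tr law_gamma a' card_state).
pose G : finZmodType := 'rV['Z_N]_n.
pose pi (x : T) : G := reduce N (val x).
have cardG : #|G| = (N ^ n)%N by exact: card_modN.
pose plaws a' s' := map (push pi) (path_laws gamma tr a' s').
have [s1 [b [s2 [es theta_le pos spr]]]] :
    exists s1 b s2, [/\ s = s1 ++ b :: s2,
     2^-1 ^+ (4 * S) <= step_prob gamma tr (last (start a) s1) b,
     0 < step_prob gamma tr (last (start a) s1) b &
     spread (push pi (step_law gamma tr (last (start a) s1) b)) (convs (plaws b s2)) <= c].
  have := @good_step R T (state a) G pi gamma tr law_gamma c (2^-1 ^+ (4 * S)) k (start a) s ps (ltW c_gt0) k_gt0.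
  apply; first by rewrite sM.
  by rewrite sM cardG.
set nu := step_law gamma tr _ b in spr.
have law_nu : law nu by exact: law_step.
set q := convs (plaws b s2) in spr.
(* Samples making this transition whose translate of [q] is near the mixture; two of them give
   translates within [20 * c] of each other. *)
pose U (x : T) := (tr (last (start a) s1) x == b) &&
  (\sum_z `|q (z - pi x) - conv (push pi nu) q z| <= 10 * c).
pose d (v : 'rV[int]_n) := shift_dist q (reduce N v).
have UU x x' : U x -> U x' -> d (val x - val x') <= 20 * c.
  move=> /andP[_ h] /andP[_ h']; rewrite /d reduceB.
  by apply: le_trans (shift_distB_le _ (conv (push pi nu) q) _ _) _; rewrite -/(pi x) -/(pi x'); lra.
(* The conditional law gives [U] mass at least [9/10]; multiplying by the transition probability
   returns to [gamma]. *)
have massU : 9 / 10 * 2^-1 ^+ (4 * S) <= \sum_(x | U x) gamma x.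
  apply: (@le_trans _ _ (9 / 10 * step_prob gamma tr (last (start a) s1) b)).
    by rewrite ler_wpM2l.
  rewrite -ler_pdivlMr //; apply: le_trans (close_mass law_nu c_gt0 spr) _.
  rewrite mulr_suml big_mkcond [leRHS]big_mkcond /=; apply: ler_sum => x _.
  rewrite /U /nu /step_law; case: ifP => _; last by rewrite andbF.
  by rewrite andbT; case: ifP.
have [] := @quotient_sketch R n K Lm (4 * S) h0 d (20 * c) g B => //.
- by rewrite /d reduce0 shift_dist0.
- by move=> v; rewrite /d reduceN shift_distN.
- by move=> v w; rewrite /d reduceD; exact: shift_distD.
- by rewrite mulr_ge0 // ltW.
- move=> vs sep bd; apply: (packing massU bd).
    apply: pairwise_uniq sep => v.
    by rewrite subrr /d reduce0 shift_dist0 mulr_ge0 // ltW.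
  (* Two translates of [U] that meet would make [v - v'] a difference of elements of [U], hence
     small for [d]. *)
  move=> v v' x x' vvs v'vs Ux Ux' e; apply/eqP; apply: contraT => vv'.
  have dvv : d (v - v') <= 20 * c.
    have -> : v - v' = val x' - val x.
      by apply/eqP; rewrite subr_eq addrAC -e addrAC subrr add0r.
    exact: UU.
  have dvv' : d (v' - v) <= 20 * c by rewrite -opprB /d reduceN shift_distN.
  have [i iv ei] := nthP 0 vvs; have [j jv ej] := nthP 0 v'vs.
  have := pairwiseP 0 sep; rewrite /= => hp.
  have : i != j by apply: contra vv' => /eqP ij; rewrite -ei -ej ij.
  rewrite neq_ltn => /orP[] ij.
    by have := hp i j iv jv ij; rewrite ei ej dvv.
  by have := hp j i jv iv ij; rewrite ei ej dvv'.
move=> p [A [pS finA cardA kerA]]; exists p, A; split=> //.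
pose h (v : 'rV[int]_n) := answer (foldl (@step _ _ a) (last (start a) s) (can v)).
pose X := [set v | exists y (t : seq T), size t = M /\ v = vy y - \sum_(x <- t) val x].
(* By [N_large], a residue determines its element of [X], so [xget] recovers it; [0] is the default
   at residues not attained. *)
pose out (z : G) : O := h (xget 0 (X `&` [set v | reduce N v = z])).
have sum_coord (t : seq T) i : `|(\sum_(x <- t) val x) 0 i| <= (size t * mx)%:Z.
  elim: t => [|x t IH]; first by rewrite big_nil mxE normr0.
  rewrite big_cons mxE /= mulSn PoszD; apply: le_trans (ler_normD _ _) _.
  exact: lerD.
have outE y (t : seq T) : size t = M ->
    out (reduce N (vy y - \sum_(x <- t) val x)) = h (vy y - \sum_(x <- t) val x).
  move=> tM; rewrite /out; congr h; case: xgetP => [v _ [[y' [t' [t'M ->]]] /=]|]; last first.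
    by move=> /(_ (vy y - \sum_(x <- t) val x)) []; split=> //; exists y, t.
  have st := sum_coord t; rewrite tM in st; have st' := sum_coord t'; rewrite t'M in st'.
  apply: reduce_inj => // i; rewrite !mxE.
  exact: dist_lt_mod (coord_y y' y i) (st' i) (st i) N_large.
pose full := convs (plaws (start a) s).
have law_full : law full by apply: law_convs; exact: (law_plaws law_gamma ps).
exists G, (fun y z => full (reduce N y - z)), out; split.
- move=> y; case: law_full => f0 f1; split=> [z|]; first exact: f0.
  by rewrite -f1 [RHS](reindex_inj (inj_comp (addrI (reduce N y)) oppr_inj)).
- apply: le_trans Es.
  pose phi (z : G) := \sum_y I y * fails (vy y) (out (reduce N (vy y) - z)).
  have -> : lexpect (path_laws gamma tr (start a) s) F =
            lexpect (path_laws gamma tr (start a) s) (fun t => phi (\sum_(x <- t) pi x)).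
    apply: eq_lexpect_path => t ht; apply: eq_bigr => y _.
    have tM : size t = M by rewrite -sM -ht size_scanl.
    rewrite -reduce_sum -reduceB outE // /h -ht.
    by congr (_ * fails _ (answer (foldl _ _ _))); elim: (t) (start a) => //= x t' IH a'; rewrite IH.
  rewrite lexpect_convs /phi -/full.
  under [leRHS]eq_bigr do rewrite mulr_sumr.
  rewrite [leRHS]exchange_big /=; apply: ler_sum => y _.
  rewrite [leRHS](reindex_inj (inj_comp (addrI (reduce N (vy y))) oppr_inj)) mulr_sumr.
  apply: ler_sum => z _ /=; rewrite mulrCA.
  by rewrite opprD opprK addrA subrr add0r.
- move=> y y' /kerA/(_ (diam_y _ _)); apply: le_trans.
  (* The whole sum convolves [q] with further laws, so it is at least as invariant under the shift
     as [q]. *)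
  apply: (@le_trans _ _ (shift_dist full (reduce N (vy y - vy y')))); last first.
    rewrite /d /full /q es /plaws.
    have split_laws : path_laws gamma tr (start a) (s1 ++ b :: s2) =
       (path_laws gamma tr (start a) s1 ++ [:: nu]) ++ path_laws gamma tr b s2.
      by rewrite /nu; elim: (s1) (start a) => //= b' s1' IH a'; rewrite IH.
    rewrite split_laws map_cat; apply: shift_dist_cat => mu hmu.
    apply: (law_plaws law_gamma ps); rewrite es.
    by rewrite split_laws map_cat; apply: (@In_catl _ mu _ (map (push pi) (path_laws gamma tr b s2))); exact: hmu.
  rewrite /shift_dist [leRHS](reindex_inj (inj_comp (addrI (reduce N (vy y))) oppr_inj)) /=.
  apply: ler_sum => z _; rewrite distrC reduceB.
  suff -> : reduce N (vy y) - z - (reduce N (vy y) - reduce N (vy y')) = reduce N (vy y') - z by [].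
  by rewrite opprB [_ - z]addrC -addrA [_ + (_ - _)]addrCA subrr addr0 addrC.
Qed.

End FiniteCore.

(** * Truncated discrete Gaussians *)

Lemma pmf_support_finite (R : realType) n (I : 'rV[int]_n -> R) (D : R) :
  is_pmf I -> support_diam_le I D ->
  (exists y, I y != 0) /\ finite_set [set y | I y != 0].
Proof.
move=> [I0 I1] hD.
have [y0 hy0] : exists y, I y != 0.
  apply: contrapT => h; move: I1; rewrite esum1 => [[]/esym/eqP|y _]; first by rewrite oner_eq0.
  by congr EFin; apply/eqP; apply: contrapT => /negP hy; apply: h; exists y.
split; first by exists y0.
apply: sub_finite_set (finite_l2ball y0 D) => y /= hy; exact: hD.
Qed.

Section GaussianMass.
Variables (R : realType) (n r : nat) (rho : R).

Let w := @gauss_weight R n r.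
Let total := \esum_(y in [set: 'rV[int]_n]) (w y)%:E.

Lemma gauss_weight_gt0 (x : 'rV[int]_n) : 0 < gauss_weight r x :> R.
Proof. exact: expR_gt0. Qed.

(** An infinite total has [fine] value 0, and division by it gives 0. This case is carried along in
    place of a proof that the sum converges. *)
Lemma trunc_gauss_degenerate : total = +oo%E -> forall x, @trunc_gauss R n r rho x = 0.
Proof.
move=> h x; rewrite /trunc_gauss /conditioned /discrete_gauss -/w -/total h /= invr0 mulr0 mul0r.
by case: ifP.
Qed.

Lemma sum_gauss_le (s : seq 'rV[int]_n) : total \is a fin_num -> uniq s ->
  \sum_(v <- s) w v <= fine total.
Proof.
move=> fin us; rewrite -lee_fin fineK // -sumEFin; apply: esum_ge.
exists [set` s]; first by split; [exact: finite_seq | by []].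
by rewrite fsbig_seq.
Qed.

Hypothesis fin_total : total \is a fin_num.

Lemma fine_total_gt0 : 0 < fine total.
Proof.
have := sum_gauss_le fin_total (isT : uniq [:: 0]); rewrite big_seq1.
by apply: lt_le_trans; exact: gauss_weight_gt0.
Qed.

(** Any finite partial sum splits at the ball; its outer part is at most [r ^- 100 <= 1/100] of the
    total, since [r >= 2]. *)
Lemma ball_mass (B : {fset 'rV[int]_n}) : (forall v : 'rV[int]_n, (v \in B) = (l2norm v <= rho)) -> (2 <= r)%N ->
  (prob (@discrete_gauss R n r) (~` euclid_ball rho) <= (r%:R ^- 100)%:E)%E ->
  99 / 100 * fine total <= \sum_(v <- B) w v.
Proof.
move=> hB r2 hc; have Z0 := fine_total_gt0; have r_gt0 : (0 < r)%N by exact: ltnW.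
suff : fine total <= \sum_(v <- B) w v + fine total * (r%:R ^- 100).
  have : (r%:R ^- 100 : R) <= 100^-1.
    rewrite lef_pV2 ?posrE ?exprn_gt0 ?ltr0n // -natrX ler_nat.
    exact: ltnW (ltn_expl 100 r2).
  by move=> h1 h2; nra.
rewrite -lee_fin fineK //; apply: ub_ereal_sup => _ [X [finX _] <-].
rewrite fsbig_finite //= sumEFin lee_fin.
rewrite (bigID (fun v => v \in B)) /=; apply: lerD.
  rewrite -big_filter; set l := [seq _ <- _ | _].
  have ul : uniq l by rewrite filter_uniq // fset_uniq.
  rewrite [leRHS](bigID (fun v => v \in l)) /= -[leLHS]addr0; apply: lerD; last first.
    by apply: sumr_ge0 => v _; exact: ltW (gauss_weight_gt0 _).
  rewrite -[leRHS]big_filter.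
  rewrite le_eqVlt; apply/orP; left; apply/eqP; apply: perm_big; apply: uniq_perm => //.
    by rewrite filter_uniq // fset_uniq.
  by move=> v; rewrite [RHS]mem_filter; case: (boolP (v \in l)) => //=; rewrite mem_filter => /andP[].
rewrite mulrC -ler_pdivrMr // mulr_suml -lee_fin; apply: le_trans hc.
rewrite -big_filter -sumEFin; set l := [seq _ <- _ | _].
have ul : uniq l by rewrite filter_uniq // fset_uniq.
apply: esum_ge; exists [set` l]; last by rewrite fsbig_seq.
split; first exact: finite_seq.
by move=> v /=; rewrite mem_filter hB => /andP[/negP h _] /=.
Qed.

Lemma trunc_gaussE (B : {fset 'rV[int]_n}) : (forall v : 'rV[int]_n, (v \in B) = (l2norm v <= rho)) ->
  0 < \sum_(v <- B) w v ->
  forall x, trunc_gauss r rho x = if x \in B then w x / \sum_(v <- B) w v else 0.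
Proof.
move=> hB W0 x; have Z0 := fine_total_gt0.
have ballE : @euclid_ball R n rho = [set` B] by apply/seteqP; split=> v /=; rewrite hB.
have h : prob (@discrete_gauss R n r) (euclid_ball rho) = ((\sum_(v <- B) w v) / fine total)%:E.
  rewrite /prob ballE esum_fset; [|exact: finite_fset|].
    rewrite fsbig_finite ?set_fsetK; last exact: finite_fset.
    by rewrite sumEFin mulr_suml.
  by move=> v _; rewrite lee_fin divr_ge0 ?ltW // gauss_weight_gt0.
rewrite /trunc_gauss /conditioned h /= /discrete_gauss -/w -/total ballE.
have -> : (x \in [set` B]) = (x \in B) by apply/idP/idP => [/set_mem|?]; last exact/mem_set.
by case: ifP => // _; field; rewrite !gt_eqF.
Qed.

End GaussianMass.

(** The squared norm grows by at most [n * (2 * rho * m + m ^ 2)]; then [pi < 4] and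
    [exp (- t) >= 1 - t]. *)
Lemma gauss_weight_shift (R : realType) n r (rho m : R) (x v : 'rV[int]_n) :
  (0 < r)%N -> l2norm x <= rho -> 0 <= m ->
  (forall i, 0 <= (v 0 i)%:~R :> R) -> (forall i, (v 0 i)%:~R <= m) ->
  4 * (n%:R * (2 * rho * m + m ^+ 2)) / r%:R ^+ 2 <= 5 / 100 ->
  95 / 100 * gauss_weight r x <= gauss_weight r (x + v) :> R.
Proof.
move=> r0 hx m0 v0 vm hsmall; rewrite /gauss_weight /l2norm.
have ss (y : 'rV[int]_n) : 0 <= \sum_i (y 0 i)%:~R ^+ 2 :> R.
  by apply: sumr_ge0 => i _; exact: sqr_ge0.
rewrite !sqr_sqrtr //; set a := \sum_i _; set b := \sum_i _.
have rho0 : 0 <= rho by exact: le_trans (l2norm_ge0 _ _) hx.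
have rr : 0 < r%:R ^+ 2 :> R by rewrite exprn_gt0 // ltr0n.
have ba : b - a <= n%:R * (2 * rho * m + m ^+ 2).
  rewrite /a /b -sumrB mulr_natl; set C := _ + m ^+ 2.
  rewrite (_ : C *+ n = \sum_(i < n) C); last by rewrite sumr_const card_ord.
  apply: ler_sum => i _; rewrite mxE rmorphD /=.
  have h2 : 0 <= (v ord0 i)%:~R :> R := v0 i.
  have h3 : (v ord0 i)%:~R <= m := vm i.
  have h4 : (x ord0 i)%:~R <= rho.
    exact: le_trans (ler_norm _) (le_trans (coord_le_l2norm R x i) hx).
  rewrite /C; move: ((x ord0 i)%:~R : R) ((v ord0 i)%:~R : R) h2 h3 h4 => X V h2 h3 h4.
  have h5 : X * V <= rho * m.
    by apply: le_trans (_ : rho * V <= _); [rewrite ler_wpM2r | rewrite ler_wpM2l].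
  have h6 : V ^+ 2 <= m ^+ 2 by rewrite ler_pXn2r ?nnegrE.
  by rewrite sqrrD; lra.
have pi4 : (pi : R) < 4 by have := pihalf_lt2 R; lra.
have small : pi * (b - a) / r%:R ^+ 2 <= 5 / 100.
  apply: le_trans hsmall; rewrite ler_pM2r ?invr_gt0 //.
  apply: (@le_trans _ _ (pi * (n%:R * (2 * rho * m + m ^+ 2)))).
    by rewrite ler_wpM2l // pi_ge0.
  by rewrite ler_wpM2r ?(ltW pi4) // mulr_ge0 // addr_ge0 ?exprn_ge0 // !mulr_ge0.
have -> : - pi * b / r%:R ^+ 2 = - pi * a / r%:R ^+ 2 + - (pi * (b - a) / r%:R ^+ 2).
  by field; rewrite gt_eqF // ltr0n.
rewrite expRD mulrC ler_pM2l ?expR_gt0 //; apply: le_trans (expR_ge1Dx _); lra.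
Qed.

Lemma gauss_packing (R : realType) n r (rho m : R) (S : nat) (B : {fset 'rV[int]_n}) :
  (1 < r)%N -> (forall v : 'rV[int]_n, (v \in B) = (l2norm v <= rho)) ->
  \esum_(y in [set: 'rV[int]_n]) (gauss_weight r y : R)%:E \is a fin_num ->
  (prob (@discrete_gauss R n r) (~` euclid_ball rho) <= (r%:R ^- 100)%:E)%E ->
  0 <= m -> 4 * (n%:R * (2 * rho * m + m ^+ 2)) / r%:R ^+ 2 <= 5 / 100 ->
  law (fun x : B => trunc_gauss r rho (val x)) /\
  forall (U : pred B) (vs : seq 'rV[int]_n),
  9 / 10 * 2^-1 ^+ (4 * S) <= \sum_(x | U x) trunc_gauss r rho (val x) ->
  (forall v, v \in vs -> forall j, 0 <= ((v 0 j)%:~R : R) <= m) -> uniq vs ->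
  (forall v v' x x', v \in vs -> v' \in vs -> U x -> U x' ->
     val x + v = val x' + v' -> v = v') ->
  (size vs < 2 ^ (4 * S).+1)%N.
Proof.
move=> r1 hB fin hc m0 hsmall; have r0 : (0 < r)%N by exact: ltnW.
have mass := ball_mass fin hB r1 hc; have Z0 := fine_total_gt0 fin.
set Z := fine _ in mass Z0.
have sumB (f : 'rV[int]_n -> R) : \sum_(v <- B) f v = \sum_(x : B) f (val x).
  by rewrite big_seq_fsetE.
have W0 : 0 < \sum_(v <- B) gauss_weight r v :> R by apply: lt_le_trans mass; rewrite mulr_gt0.
have gE (x : B) : trunc_gauss r rho (val x) =
    gauss_weight r (val x) / \sum_(v <- B) gauss_weight r v.
  by rewrite (trunc_gaussE fin hB W0) (valP x).
split.
  split=> [x|]; first by rewrite gE divr_ge0 // ltW // gauss_weight_gt0.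
  under eq_bigr do rewrite gE.
  by rewrite -mulr_suml -(sumB (gauss_weight r)) divff // gt_eqF.
move=> U vs hU vb uvs dis.
apply: (@packing_bound R _ B val (gauss_weight r) Z (2^-1 ^+ (4 * S)) S U vs) => //.
- by move=> v; exact: ltW (gauss_weight_gt0 _ _ _).
- by move=> s us; exact: sum_gauss_le.
- by rewrite -(sumB (gauss_weight r)).
- by rewrite -(sumB (gauss_weight r)).
- rewrite -(sumB (gauss_weight r)) -ler_pdivlMr // mulr_suml.
  by apply: le_trans hU _; apply: ler_sum => x _; rewrite gE.
- move=> v x vvs; apply: (@gauss_weight_shift R n r rho m) => //.
  + by rewrite -hB (valP x).
  + by move=> i; have /andP[] := vb v vvs i.
  + by move=> i; have /andP[] := vb v vvs i.
Qed.

Lemma law_support (R : realType) (U : choiceType) (p : U -> R) (Y : {fset U}) :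
  is_pmf p -> (forall u, p u != 0 -> u \in Y) -> law (fun y : Y => p (val y)).
Proof.
move=> [p0 p1] pY; split=> //.
have h : \esum_(u in [set: U]) (p u)%:E = (\sum_(y : Y) p (val y))%:E.
  apply: (@esum_EFin_supported _ Y _ val) => //.
  by move=> u /pY uY; exists [` uY]%fset.
by move: p1; rewrite h => -[].
Qed.

Lemma law_pair (R : realType) (A B : finType) (p : A -> R) (q : B -> R) :
  law p -> law q -> law (fun z : A * B => p z.1 * q z.2).
Proof.
move=> [p0 p1] [q0 q1]; split=> [z|]; first exact: mulr_ge0.
rewrite -(pair_big xpredT xpredT (fun a b => p a * q b)) /= -p1.
by apply: eq_bigr => a _; rewrite -mulr_sumr q1 mulr1.
Qed.

Lemma law_prod (R : realType) (T : finType) (gamma : T -> R) M : law gamma ->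
  law (fun x : {ffun 'I_M -> T} => \prod_j gamma (x j)).
Proof.
move=> [g0 g1]; split=> [x|]; first exact: prodr_ge0.
by rewrite -(bigA_distr_bigA (fun _ : 'I_M => gamma)) /= big1.
Qed.

(** Both laws have finite support, so the success probability is a finite sum and one seed attains
    its mean; the final frequency vector is [y] by [freq_exact_stream]. *)
Lemma solvable_finite (R : realType) n r (rho : R) (I : 'rV[int]_n -> R) (O : Type)
    (rel : 'rV[int]_n -> O -> Prop) (delta : R) s (Y B : {fset 'rV[int]_n}) :
  is_pmf I -> (forall y, I y != 0 -> y \in Y) ->
  (forall x, trunc_gauss r rho x != 0 -> x \in B) ->
  law (fun x : B => trunc_gauss r rho (val x)) ->
  solvable_in_space r rho I rel delta s ->
  exists2 a : det_alg n O, (#|state a| <= 2 ^ s)%N &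
    \sum_(y : Y) I (val y) * \sum_(x : {ffun 'I_(r ^ 2) -> B})
      (\prod_j trunc_gauss r rho (val (x j))) *
      fails R rel (val y) (run a (exact_stream (val y) [ffun j => val (x j)])) <= delta.
Proof.
move=> pI IY gB lg [d [W [P [alg [space [meas succ]]]]]].
have lI := law_support pI IY.
pose Z : finType := (Y * {ffun 'I_(r ^ 2) -> B})%type.
pose emb (z : Z) : 'rV[int]_n * {ffun 'I_(r ^ 2) -> 'rV[int]_n} :=
  (val z.1, [ffun j => val (z.2 j)]).
have emb_inj : injective emb.
  move=> [y x] [y' x'] [/val_inj-> /ffunP e]; congr (_, _); apply/ffunP => j.
  by have := e j; rewrite !ffunE => /val_inj.
pose c (z : Z) := I (val z.1) * \prod_j trunc_gauss r rho (val (z.2 j)).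
have lc : law c by apply: (law_pair lI (law_prod _ lg)).
pose V (z : Z) := valid_seeds rel alg (exact_stream (emb z).1 (emb z).2).
have pmf_emb z : exact_pmf rho I (emb z) = c z.
  by rewrite /exact_pmf /c; congr (_ * _); apply: eq_bigr => j _; rewrite ffunE.
have pmf_ge0 z : 0 <= exact_pmf (r := r) rho I z.
  rewrite /exact_pmf mulr_ge0 //; first by case: pI.
  apply: prodr_ge0 => j _; have [->//|/gB h] := eqVneq (trunc_gauss r rho (z.2 j)) 0.
  by case: lg => /(_ [` h]%fset).
have [w hw] : exists w, 1 - delta <= \sum_(z | w \in V z) c z.
  apply: (choose_seed (P := P) (V := V)); first by case: lc.
    by move=> z; exact: meas.
  rewrite (esum_supported emb_inj) in succ.
  - by move: succ; under eq_bigr do rewrite pmf_emb.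
  - by move=> z; rewrite mule_ge0 // lee_fin.
  move=> [y x] hz.
  have : exact_pmf rho I (y, x) != 0 by apply: contra hz => /eqP->; rewrite mul0e.
  rewrite /exact_pmf mulf_eq0 negb_or /= => /andP[/IY yY /prodf_neq0 hx].
  have xB j : x j \in B by apply: gB; exact: hx.
  exists ([` yY]%fset, [ffun j => [` xB j]%fset]); rewrite /emb /=; congr (_, _).
  by apply/ffunP => j; rewrite !ffunE.
exists (alg w) => //.
have -> : \sum_(y : Y) I (val y) * \sum_(x : {ffun 'I_(r ^ 2) -> B})
      (\prod_j trunc_gauss r rho (val (x j))) *
      fails R rel (val y) (run (alg w) (exact_stream (val y) [ffun j => val (x j)])) =
   \sum_(z | w \notin V z) c z.
  under eq_bigr do rewrite mulr_sumr.
  rewrite pair_big [RHS]big_mkcond /=; apply: eq_bigr => z _.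
  rewrite mulrA -/(c z) /fails; case: ifPn => hz.
    rewrite asboolT ?mulr1 // => hr; move/negP: hz; apply; apply/mem_set.
    by rewrite /V /valid_seeds /= freq_exact_stream.
  rewrite asboolF ?mulr0 //; apply; move: hz; rewrite negbK => /set_mem.
  by rewrite /V /valid_seeds /= freq_exact_stream.
by case: lc => _; rewrite (bigID (fun z => w \in V z)) /= => e; lra.
Qed.

(** * Numerical choices *)

Section Root50.
Variables (R : realType) (r : nat).
Hypothesis r_gt0 : (0 < r)%N.

(* All quantities of the proof are compared with powers of [root50 = r ^ (1 / 50) >= n]. *)
Definition root50 : R := r%:R `^ 50^-1.

Lemma root50_gt0 : 0 < root50.
Proof. by rewrite powR_gt0 // ltr0n. Qed.

Lemma root50K : root50 ^+ 50 = r%:R.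
Proof.
rewrite -powR_mulrn ?(ltW root50_gt0) // -powRrM mulVf ?pnatr_eq0 //.
by rewrite powRr1.
Qed.

Lemma le_root50 (m : nat) : (m ^ 50 <= r)%N -> m%:R <= root50.
Proof.
move=> h; rewrite -(@ler_pXn2r _ 50) ?nnegrE ?(ltW root50_gt0) //.
by rewrite root50K -natrX ler_nat.
Qed.

Lemma ln_root50 : ln (r%:R : R) = 50 * ln root50.
Proof. by rewrite -root50K lnXn ?root50_gt0 // mulr_natl. Qed.

(** Because [50 / 3 <= 17]. *)
Lemma cube_root_le (D : R) : 1 <= root50 -> D <= r%:R `^ 3^-1 -> D <= root50 ^+ 17.
Proof.
move=> u1 /le_trans; apply.
rewrite -(@ler_pXn2r _ 3) ?nnegrE ?powR_ge0 ?exprn_ge0 ?(ltW root50_gt0) //.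
have -> : (r%:R `^ 3^-1) ^+ 3 = r%:R :> R.
  by rewrite -powR_mulrn ?powR_ge0 // -powRrM mulVf ?pnatr_eq0 // powRr1.
by rewrite -root50K -exprM ler_weXn2l.
Qed.

End Root50.

Lemma ln2_ge_half (R : realType) : 1 / 2 <= ln (2 : R).
Proof.
have := @le_ln1Dx R (- (1 / 2)); rewrite (_ : 1 - 1 / 2 = 2^-1); last by field.
by rewrite lnV ?posrE // => h; have := h ltac:(lra); lra.
Qed.

(** Chosen with [K - 2 > 10 * h / ln r], so that [(1 + 1 / (K - 2)) ^ h <= exp (ln r / 10)], the
    fifth power of [root50]; the summand 3 ensures [K > 2]. *)
Definition radix (R : realType) (h r : nat) : nat :=
  (3 + Num.trunc (10 * h%:R / ln (r%:R : R)))%N.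

Lemma radix_growth (R : realType) (h r : nat) (u : R) : 0 < u -> u ^+ 50 = r%:R -> 1 <= ln u ->
  (1 + ((radix R h r)%:R - 2)^-1) ^+ h <= u ^+ 5.
Proof.
move=> u0 ur lu; have lr : ln (r%:R : R) = 50 * ln u by rewrite -ur lnXn // mulr_natl.
set x := 10 * h%:R / ln (r%:R : R).
have x0 : 0 <= x by rewrite divr_ge0 ?mulr_ge0 // lr; lra.
have kx : x < (radix R h r)%:R - 2.
  rewrite /radix -/x natrD; have := truncnS_gt x; rewrite -natr1; lra.
set k := _ - 2 in kx *; have k0 : 0 < k by exact: le_lt_trans kx.
apply: (@le_trans _ _ (expR (k^-1) ^+ h)).
  by rewrite lerXn2r ?nnegrE ?expR_ge0 ?addr_ge0 ?invr_ge0 ?(ltW k0) // expR_ge1Dx.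
rewrite -expRM_natl -[u in leRHS]lnK ?posrE // -expRM_natl ler_expR.
rewrite ler_pdivrMr //.
apply: (@le_trans _ _ (5 * ln u * x)); last by rewrite ler_wpM2l ?(ltW kx) // mulr_ge0 //; lra.
rewrite /x lr le_eqVlt; apply/orP; left; apply/eqP; field; lra.
Qed.

Lemma radix_le (R : realType) (h r : nat) (u : R) : u ^+ 50 = r%:R -> 20 <= u ->
  h%:R <= u -> 1 <= ln u -> (radix R h r)%:R <= u ^+ 2.
Proof.
move=> ur u20 hu lu; have lr : ln (r%:R : R) = 50 * ln u by rewrite -ur lnXn ?mulr_natl //; lra.
set x := 10 * h%:R / ln (r%:R : R).
have xu : x <= u.
  rewrite /x lr ler_pdivrMr ?mulr_gt0 //; last lra.
  by have h0 : 0 <= (h%:R : R) by []; nra.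
have x0 : 0 <= x by rewrite divr_ge0 ?mulr_ge0 // lr; lra.
rewrite /radix -/x natrD; have : (Num.trunc x)%:R <= x by rewrite truncn_le.
by nra.
Qed.

(* [2 K <= (2 + s / log2 r) ^ 9]. *)
Lemma radix_card (R : realType) (h s r : nat) : (h <= 4 * s)%N -> 0 < ln (r%:R : R) ->
  ((2 * radix R h r)%:R : R) ^+ (8 * (4 * s)) <= (2 + s%:R / log2 (r%:R : R)) ^+ (288 * s).
Proof.
move=> hs lr; set X := s%:R / log2 (r%:R : R).
have l2 := ln2_ge_half R.
have X0 : 0 <= X by rewrite divr_ge0 // /log2 divr_ge0 //; lra.
(* From [40 <= 80 * ln 2] comes [2 * K <= 6 + 160 * X <= 2 ^ 8 * (2 + X) <= (2 + X) ^ 9], and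
   [288 = 9 * 32]. *)
have -> : (288 * s = 9 * (8 * (4 * s)))%N by rewrite !mulnA.
rewrite [leRHS]exprM lerXn2r ?nnegrE ?ler0n ?exprn_ge0 ?addr_ge0 //.
set x := 10 * h%:R / ln (r%:R : R).
have x0 : 0 <= x by rewrite divr_ge0 ?mulr_ge0 //; lra.
have xX : x <= 80 * X.
  have -> : X = s%:R * ln 2 / ln (r%:R : R) by rewrite /X /log2; field; lra.
  rewrite /x mulrA ler_pM2r ?invr_gt0 //.
  have h4 : h%:R <= 4 * s%:R :> R by rewrite -(natrM _ 4) ler_nat.
  have s0 : 0 <= s%:R :> R by [].
  by nra.
have : (Num.trunc x)%:R <= x by rewrite truncn_le.
rewrite natrM /radix -/x natrD => tx.
have e8 : 2 ^+ 8 <= (2 + X) ^+ 8 by rewrite lerXn2r ?nnegrE ?addr_ge0 // lerDl.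
rewrite exprS; have : (2 + X) * 2 ^+ 8 <= (2 + X) * (2 + X) ^+ 8.
  by rewrite ler_wpM2l // addr_ge0.
by lra.
Qed.

(* [k = r = u^50] balances the entropy term against the [2 / k] term. *)
Lemma entropy_budget (R : realType) (n r : nat) (u : R) : u ^+ 50 = r%:R -> 20 <= u ->
  n%:R <= u ->
  r%:R / 2 * ln ((((r ^ 4) ^ n)%N)%:R : R) + 2 / r%:R * ((r ^ 2)%N)%:R <
  (u ^+ 46)^-1 / 2 * ((r ^ 2)%N)%:R.
Proof.
move=> ur u20 nu; have u0 : 0 < u by lra.
have lu : ln u <= u by exact: ltW (ln_sublinear u0).
have lu0 : 0 <= ln u by rewrite ln_ge0 //; lra.
rewrite !natrX -ur.
have -> : ln (((u ^+ 50) ^+ 4) ^+ n) = n%:R * (200 * ln u).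
  by rewrite -!exprM lnXn // -[_ *+ _]mulr_natl natrM; ring.
have L : n%:R * (200 * ln u) <= 200 * u ^+ 2.
  by have n0 : 0 <= n%:R :> R by []; nra.
set L1 := n%:R * _ in L *.
have -> : (u ^+ 46)^-1 / 2 * (u ^+ 50) ^+ 2 = u ^+ 54 / 2 by field; rewrite gt_eqF.
have -> : 2 / u ^+ 50 * (u ^+ 50) ^+ 2 = 2 * u ^+ 50 by field; rewrite gt_eqF.
have p50 : 0 < u ^+ 50 by rewrite exprn_gt0.
apply: (@le_lt_trans _ _ (u ^+ 50 / 2 * (200 * u ^+ 2) + 2 * u ^+ 50)).
  by rewrite lerD2r ler_wpM2l // divr_ge0 // ltW.
rewrite -subr_gt0.
have -> : u ^+ 54 / 2 - (u ^+ 50 / 2 * (200 * u ^+ 2) + 2 * u ^+ 50) =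
  u ^+ 50 * ((u ^+ 2) ^+ 2 / 2 - 100 * u ^+ 2 - 2) by field.
rewrite mulr_gt0 //; have : 400 <= u ^+ 2 by nra.
by set v := u ^+ 2; nra.
Qed.

(** Here [X = K ^ Lm] with [Lm] maximal for [X ^ 4 <= r]: so [X] is small enough for Gaussian
    shifts, while [X ^ 8 >= X ^ 4 * K ^ 4 > u ^ 50] exceeds [2 * u ^ 36]. *)
Lemma window_room (R : realType) (u X K Xb : R) : 20 <= u -> 1 <= K -> K <= X -> K <= u ^+ 2 ->
  X ^+ 4 <= u ^+ 50 -> u ^+ 50 < X ^+ 4 * K ^+ 4 -> Xb = X ^+ 8 ->
  X <= u ^+ 13 /\ u ^+ 18 + X * (u ^+ 18 * u ^+ 5) < Xb.
Proof.
move=> u20 K1 KX Ku X4 X4K ->; have u0 : 0 < u by lra.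
have X0 : 0 <= X by lra.
have u1 : 1 <= u by lra.
have Xu : X <= u ^+ 13.
  rewrite -(@ler_pXn2r _ 4) ?nnegrE ?exprn_ge0 ?(ltW u0) //.
  by apply: le_trans X4 _; rewrite -exprM ler_weXn2l.
split=> //; apply: lt_le_trans (_ : u ^+ 50 <= _); last first.
  apply: le_trans (ltW X4K) _; rewrite -[8%N]/(4 + 4)%N exprD ler_wpM2l ?exprn_ge0 //.
  by rewrite lerXn2r ?nnegrE //; lra.
apply: (@le_lt_trans _ _ (u ^+ 36 + u ^+ 36)).
  apply: lerD; first by rewrite ler_weXn2l.
  rewrite -exprD; apply: le_trans (ler_wpM2r _ Xu) _; first by rewrite exprn_ge0 // ltW.
  by rewrite -exprD.
rewrite -[50%N]/(36 + 14)%N exprD -mulr2n -mulr_natr ltr_pM2l ?exprn_gt0 //.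
by apply: (@lt_le_trans _ _ u); [lra | rewrite -[leLHS]expr1 ler_weXn2l].
Qed.

(** The numerator is at most [12 * u ^ 66], the denominator is [u ^ 100]. *)
Lemma shift_small (R : realType) (n r : nat) (u rho X : R) : u ^+ 50 = r%:R -> 20 <= u ->
  n%:R <= u -> 0 <= X -> X <= u ^+ 13 -> 0 <= rho -> rho <= u ^+ 52 ->
  4 * (n%:R * (2 * rho * X + X ^+ 2)) / r%:R ^+ 2 <= 5 / 100.
Proof.
move=> ur u20 nu X0 Xu rho0 rhou; have u0 : 0 < u by lra.
have u1 : 1 <= u by lra.
rewrite -ur ler_pdivrMr ?exprn_gt0 //.
have h1 : rho * X <= u ^+ 65.
  by rewrite -[65%N]/(52 + 13)%N exprD; apply: ler_pM.
have h2 : X ^+ 2 <= u ^+ 65.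
  apply: (@le_trans _ _ ((u ^+ 13) ^+ 2)); first by rewrite lerXn2r ?nnegrE ?exprn_ge0 ?(ltW u0).
  by rewrite -exprM ler_weXn2l.
have h3 : n%:R * (2 * rho * X + X ^+ 2) <= u * (3 * u ^+ 65).
  by apply: ler_pM => //; rewrite ?addr_ge0 ?exprn_ge0 ?mulr_ge0 //; lra.
apply: (@le_trans _ _ (12 * u ^+ 66)); first by rewrite exprS; lra.
rewrite -exprM -[(50 * 2)%N]/(66 + 34)%N exprD [5 / 100 * _]mulrCA mulrC.
rewrite ler_wpM2l ?exprn_ge0 ?(ltW u0) //.
apply: (@le_trans _ _ (5 / 100 * u ^+ 2)); first by nra.
by rewrite ler_wpM2l // ler_weXn2l.
Qed.

Lemma int_le_trunc (R : realType) (z : int) (x : R) : `|z%:~R| <= x -> `|z| <= (Num.trunc x)%:Z.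
Proof.
move=> h; have x0 : 0 <= x by exact: le_trans (normr_ge0 _) h.
suff : (`|z| <= Num.trunc x)%N by lia.
by rewrite truncn_ge_nat // natr_absz intr_norm.
Qed.

(** * Assembly of the simulation for the exact stream distribution *)

Definition simulates (R : realType) n r (I : 'rV[int]_n -> R) (O : Type)
    (rel : 'rV[int]_n -> O -> Prop) (delta : R) s (p : nat) (A : linear_sketch R n p 0)
    (C : finType) (P : 'rV[int]_n -> C -> R) (out : C -> O) :=
  [/\ sketch_within A 288 r s, forall y, law (P y),
      ((1 - 2 * delta)%:E <=
         \esum_(y in [set: 'rV[int]_n]) (I y * \sum_b P y b * (1 - fails R rel y (out b)))%:E)%E
    & forall y y', I y != 0 -> I y' != 0 -> A y = A y' ->
        \sum_b `|P y b - P y' b| <= (root50 R r)^-1].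

(** All streams have probability zero, so the success hypothesis forces [delta >= 1] and the zero
    sketch is enough. *)
Lemma degenerate_simulation (R : realType) n r (rho : R) (I : 'rV[int]_n -> R) (O : Type)
    (rel : 'rV[int]_n -> O -> Prop) (delta : R) s : (1 < r)%N -> is_pmf I ->
  (forall x : 'rV[int]_n, trunc_gauss r rho x = 0) ->
  solvable_in_space r rho I rel delta s ->
  exists (p : nat) (A : linear_sketch R n p 0) (C : finType) P (out : C -> O),
    simulates r I rel delta s A P out.
Proof.
move=> r1 pI g0 [d [W [P [alg [space [meas succ]]]]]].
have d1 : 1 <= delta.
  move: succ; rewrite esum1 ?lee_fin; first lra.
  move=> z _; rewrite /exact_pmf; have r20 : (0 < r ^ 2)%N by rewrite expn_gt0 ltnW.
  by rewrite (bigD1 (Ordinal r20)) //= g0 mul0r mulr0 mul0e.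
have [w _] : exists w : W, True.
  apply: contrapT => h; have := @probability_setT _ _ _ P.
  have -> : [set: W] = set0 by rewrite -subset0 => w _; apply: h; exists w.
  by rewrite measure0 => -[/esym/eqP]; rewrite oner_eq0.
pose A : linear_sketch R n 0 0 := \0.
pose z0 : sketch_group R 0 0 := 0.
exists 0%N, A, unit, (fun _ _ => 1), (fun=> run (alg w) [::]); split.
- have sub : range A `<=` [set` [fset z0]%fset].
    by move=> _ [x _ <-]; exact/fset1P.
  have fin : finite_set (range A) by apply: sub_finite_set sub _; exact: finite_fset.
  have card1 : (#|` fset_set (range A)| <= #|` [fset z0]%fset|)%N.
    by apply: fsubset_leq_card; apply/fsubsetP => a; rewrite in_fset_set // inE => /sub.
  split=> //; rewrite cardfs1 -(ler_nat R) in card1; apply: le_trans card1 _.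
  apply: exprn_ege1; have : 0 <= s%:R / log2 (r%:R : R).
    by rewrite divr_ge0 // divr_ge0 // ln_ge0 // ler1n // ltnW.
  by lra.
- by move=> y; split=> [//|]; rewrite sumr_const card_unit.
- apply: (@le_trans _ _ 0%E); first by rewrite lee_fin; lra.
  apply: esum_ge0 => y _; rewrite lee_fin mulr_ge0 //; first by case: pI.
  by apply: sumr_ge0 => b _; rewrite mul1r subr_ge0 lern1 leq_b1.
- move=> y y' _ _ _; rewrite big1 ?invr_ge0 ?powR_ge0 // => b _.
  by rewrite subrr normr0.
Qed.

Lemma gauss_total_cases (R : realType) n r :
  let total := \esum_(y in [set: 'rV[int]_n]) (gauss_weight r y : R)%:E in
  total = +oo%E \/ total \is a fin_num.
Proof.
move=> total; have : (0 <= total)%E.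
  by apply: esum_ge0 => y _; rewrite lee_fin ltW // gauss_weight_gt0.
by rewrite fin_numElt; case: total => [x _|//|//]; [right; rewrite ltNyr ltry | left].
Qed.

(** Excludes wrap-around modulo [N = r ^ 4]: the relevant range is at most
    [3 * u ^ 152 < u ^ 200]. *)
Lemma range_room (R : realType) (u a b : R) : 20 <= u -> a <= u ^+ 17 -> b <= u ^+ 52 ->
  a + 2 * ((u ^+ 50) ^+ 2 * b) < (u ^+ 50) ^+ 4.
Proof.
move=> u20 h1 h2; have u1 : 1 <= u by lra.
have p k : 0 < u ^+ k by rewrite exprn_gt0 //; lra.
have h3 : u ^+ 17 <= u ^+ 152 by rewrite ler_weXn2l.
have h4 : (u ^+ 50) ^+ 2 * b <= u ^+ 152.
  by rewrite -exprM -[152%N]/(50 * 2 + 52)%N exprD ler_wpM2l // ltW.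
have h5 : 3 * u ^+ 152 < (u ^+ 50) ^+ 4.
  rewrite -exprM -[(50 * 4)%N]/(152 + 48)%N exprD mulrC ltr_pM2l //.
  by apply: (@lt_le_trans _ _ u); [lra | rewrite -[leLHS]expr1 ler_weXn2l].
by move: (le_trans h1 h3) h4 h5; clear; move: (u ^+ 152) (_ * b) (_ ^+ 4) => x y z; lra.
Qed.

Theorem simulation (R : realType) (c1 c2 : R) : exists r0 : nat, (1 < r0)%N /\
  forall (n r : nat) (rho D : R) (I : 'rV[int]_n -> R) (s : nat) (delta : R)
    (O : Type) (rel : 'rV[int]_n -> O -> Prop),
    (r0 <= r)%N -> (n ^ 50 <= r)%N ->
    truncation_radius n c1 c2 r rho ->
    is_pmf I -> support_diam_le I D -> D <= r%:R `^ 3^-1 ->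
    solvable_in_space r rho I rel delta s ->
    [/\ 4 <= root50 R r, root50 R r ^+ 50 = r%:R &
    exists (p : nat) (A : linear_sketch R n p 0) (C : finType) P (out : C -> O),
      simulates r I rel delta s A P out].
Proof.
pose c := (Num.trunc `|c2|).+1.
(* The part [51 * c] absorbs the constant in [rho <= c * u ^ 50 * (51 * u) <= u ^ 52]; the part 1000
   covers the numerical inequalities. *)
pose U0 := (51 * c + 1000)%N.
exists (U0 ^ 50)%N; split.
  by apply: leq_trans (ltn_expl _ _); rewrite /U0; lia.
move=> n r rho D I s delta O rel hr hn [_ hrho hcomp] pI diam hD sol.
have r1 : (1 < r)%N.
  by apply: leq_trans hr; apply: leq_trans (ltn_expl _ _); rewrite /U0; lia.
have r0 : (0 < r)%N by exact: ltnW.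
set u := root50 R r.
have u0 : 0 < u := root50_gt0 R r0.
have ur : u ^+ 50 = r%:R := root50K R r0.
have nu : n%:R <= u := le_root50 R r0 hn.
have uU : U0%:R <= u := le_root50 R r0 hr.
have [uc u1000] : 51 * c%:R <= u /\ 1000 <= u.
  have : 0 <= c%:R :> R by [].
  by move: uU; rewrite /U0 natrD natrM; lra.
have u20 : 20 <= u by lra.
have u1 : 1 <= u by lra.
have lu1 : 1 <= ln u.
  have l2 := ln2_ge_half R; apply: (@le_trans _ _ (ln (2 ^+ 2))).
    by rewrite lnXn // -[_ *+ 2]mulr_natl; lra.
  by rewrite ler_ln ?posrE ?exprn_gt0 //; lra.
have lr : ln (r%:R : R) = 50 * ln u := ln_root50 R r0.
have lr0 : 0 < ln (r%:R : R) by rewrite lr; lra.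
split=> //; first lra.
have [tot|fin] := @gauss_total_cases R n r.
  apply: degenerate_simulation sol => //.
  exact: trunc_gauss_degenerate.
have [[y0 Iy0] finY] := pmf_support_finite pI diam.
pose Y := fset_set [set y | I y != 0].
have IY y : I y != 0 -> y \in Y by move=> h; rewrite /Y in_fset_set //; exact/mem_set.
have YI (y : Y) : I (val y) != 0.
  by have := valP y; rewrite /= /Y in_fset_set // => /set_mem.
have D0 : 0 <= D by exact: le_trans (l2norm_ge0 _ _) (diam _ _ Iy0 Iy0).
have Du : D <= u ^+ 17 := cube_root_le r0 u1 hD.
have finB : finite_set [set v : 'rV[int]_n | l2norm v <= rho].
  by apply: sub_finite_set (finite_l2ball 0 rho) => v /=; rewrite subr0.
pose B := fset_set [set v : 'rV[int]_n | l2norm v <= rho].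
have hB (v : 'rV[int]_n) : (v \in B) = (l2norm v <= rho).
  by rewrite /B in_fset_set //; apply/idP/idP => [/set_mem|h]; last exact/mem_set.
have rhou : rho <= u ^+ 52.
  apply: le_trans hrho _.
  have c2c : c2 <= c%:R by apply: le_trans (ler_norm _) (ltW (truncnS_gt _)).
  have sn : Num.sqrt n%:R <= u.
    apply: le_trans nu; apply: (@le_trans _ _ (Num.sqrt (n%:R ^+ 2))).
      by rewrite ler_wsqrtr // -natrX ler_nat -mulnn; case: (n) => // m; rewrite leq_pmulr.
    by rewrite sqrtr_sqr ger0_norm.
  have lu : ln u <= u by exact: ltW (ln_sublinear u0).
  have scale0 : 0 <= r%:R * (Num.sqrt n%:R + ln (r%:R : R)).
    by rewrite mulr_ge0 // addr_ge0 ?sqrtr_ge0 // ltW.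
  apply: le_trans (ler_wpM2r scale0 c2c) _.
  have p50 : 0 <= u ^+ 50 by rewrite exprn_ge0 // ltW.
  rewrite -ur; apply: (@le_trans _ _ (c%:R * (u ^+ 50 * (51 * u)))).
    by rewrite ler_wpM2l // ler_wpM2l // ur lr; lra.
  have -> : c%:R * (u ^+ 50 * (51 * u)) = u ^+ 51 * (51 * c%:R) by ring.
  by rewrite [leRHS]exprSr ler_wpM2l // exprn_ge0 // ltW.
set h0 := minn (4 * s) n.
have h0n : h0%:R <= u by apply: le_trans nu; rewrite ler_nat geq_minr.
pose K := radix R h0 r.
have K2 : (2 < K)%N by rewrite /K /radix addSn ltnS.
have Ku : K%:R <= u ^+ 2 := radix_le ur u20 h0n lu1.
have K1R : 1 <= K%:R :> R by rewrite ler1n ltnW // ltnW.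
have K4 : (1 < K ^ 4)%N by rewrite -{1}(exp1n 4) ltn_exp2r // ltnW.
pose Lm := trunc_log (K ^ 4) r.
have /andP[loL hiL] := trunc_log_bounds K4 r0.
have K4r : (K ^ 4 <= r)%N.
  rewrite -(ler_nat R) natrX -ur; apply: (@le_trans _ _ ((u ^+ 2) ^+ 4)).
    by rewrite lerXn2r ?nnegrE ?exprn_ge0 ?(ltW u0).
  by rewrite -exprM ler_weXn2l.
have Lm0 : (0 < Lm)%N.
  by rewrite /Lm trunc_log_gt0 K4 /= (leq_trans _ K4r) // prednK // ltnW.
pose X : R := K%:R ^+ Lm.
have [Xu room] : X <= u ^+ 13 /\ u ^+ 18 + X * (u ^+ 18 * u ^+ 5) < K%:R ^+ (8 * Lm).
  apply: (@window_room R u X K%:R) => //.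
  - by rewrite /X -[leLHS]expr1 ler_weXn2l.
  - by rewrite /X -exprM ur -natrX ler_nat mulnC expnM.
  - by rewrite /X -exprM ur -exprD -natrX ltr_nat -mulSnr mulnC expnM.
  - by rewrite /X -exprM mulnC.
have X0 : 0 <= X by rewrite exprn_ge0.
have [b0 hb0] : exists b : 'rV[int]_n, b \in B.
  apply: contrapT => hno.
  have := ball_mass fin hB r1 hcomp; rewrite big_seq big1 => [|v vB].
    by rewrite pmulr_rle0 ?divr_gt0 // leNgt fine_total_gt0.
  by case: hno; exists v.
have rho0 : 0 <= rho by apply: le_trans (l2norm_ge0 R b0) _; rewrite -hB.
have [lawB pack] := gauss_packing s r1 hB fin hcomp X0 (shift_small ur u20 nu X0 Xu rho0 rhou).
have gB x : trunc_gauss r rho x != 0 -> x \in B.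
  rewrite /trunc_gauss /conditioned hB; case: ifP; last by rewrite eqxx.
  by move=> /set_mem.
have [a aS err] := solvable_finite pI IY gB lawB sol.
have lawY := law_support pI IY.
pose dy := Num.trunc D; pose mx := Num.trunc rho.
have diamY (y y' : Y) i : `|((val y - val y') 0 i)%:~R| <= D :> R.
  by apply: le_trans (coord_le_l2norm _ _ _) (diam _ _ (YI y) (YI y')).
have coordY (y y' : Y) i : `|val y 0 i - val y' 0 i| <= dy%:Z.
  by apply: int_le_trunc; have := diamY y y' i; rewrite !mxE.
have coordX (x : B) i : `|val x 0 i| <= mx%:Z.
  apply: int_le_trunc; apply: le_trans (coord_le_l2norm _ _ _) _.
  by rewrite -hB; exact: valP.
have N_large : (dy + 2 * (r ^ 2 * mx) < r ^ 4)%N.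
  rewrite -(ltr_nat R) natrD (natrM _ 2) (natrM _ (r ^ 2)) (natrX _ r 2) (natrX _ r 4) -ur.
  by apply: range_room => //; [apply: le_trans Du | apply: le_trans rhou]; rewrite truncn_le.
have N_gt1 : (1 < r ^ 4)%N by rewrite -{1}(exp1n 4) ltn_exp2r.
have diamB (y y' : Y) : l1norm R (val y - val y') <= u ^+ 18.
  apply: (@le_trans _ _ (\sum_(i < n) D)); first by apply: ler_sum => i _; exact: diamY.
  rewrite sumr_const card_ord -[leLHS]mulr_natl exprS.
  by apply: ler_pM.
(* Parameters: [M = r ^ 2], [N = r ^ 4], [k = r], [c = u ^ -46], [g = u ^ 5], and [B = u ^ 18] from
   [n * D <= u * u ^ 17]. *)
have M0 : (0 < r ^ 2)%N by rewrite expn_gt0 r0.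
have k0 : 0 < r%:R :> R by rewrite ltr0n.
have c0 : 0 < (u ^+ 46)^-1 by rewrite invr_gt0 exprn_gt0.
have g1 : 1 <= u ^+ 5 by rewrite exprn_ege1.
have B0 : 0 <= u ^+ 18 by rewrite exprn_ge0 // ltW.
have growth : (1 + (K%:R - 2)^-1) ^+ h0 <= u ^+ 5 := radix_growth h0 u0 ur lu1.
have pack' (U : pred B) (vs : seq 'rV[int]_n) :
  9 / 10 * 2^-1 ^+ (4 * s) <= \sum_(x | U x) trunc_gauss r rho (val x) ->
  (forall v, v \in vs -> forall j, 0 <= v 0 j <= K%:Z ^+ Lm) -> uniq vs ->
  (forall v v' x x', v \in vs -> v' \in vs -> U x -> U x' ->
     val x + v = val x' + v' -> v = v') ->
  (size vs < 2 ^ (4 * s).+1)%N.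
  move=> hU hv; apply: pack => // v vvs j.
  have /andP[v0 vK] := hv v vvs j; rewrite ler0z v0 /=.
  by rewrite /X -[K%:R]/(K%:Z%:~R) -rmorphXn /= ler_int.
have [p [A [pS finA cardA [C [P [out [lawP errP close]]]]]]] :=
  finite_core lawB lawY aS M0 err coordY coordX N_large N_gt1 diamB k0 c0 g1 B0
    (entropy_budget ur u20 nu) K2 Lm0 (leqnn h0) growth room pack'.
exists p, A, C, P, out; split=> //.
- split=> //; first by rewrite addn0; apply: leq_trans pS _; rewrite leq_mul2r orbT.
  have := @radix_card R h0 s r (geq_minl _ _) lr0; apply: le_trans.
  by rewrite -natrX ler_nat.
- have -> : \esum_(y in [set: 'rV[int]_n])
      (I y * \sum_b P y b * (1 - fails R rel y (out b)))%:E =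
    (\sum_(y : Y) I (val y) * \sum_b P (val y) b * (1 - fails R rel (val y) (out b)))%:E.
    apply: (@esum_EFin_supported _ Y _ val) => //.
      move=> y; rewrite mulr_ge0 //; first by case: pI.
      apply: sumr_ge0 => b _; rewrite mulr_ge0 //; first by case: (lawP y).
      by rewrite subr_ge0 lern1 leq_b1.
    move=> y; rewrite mulf_eq0 negb_or => /andP[/IY yY _].
    by exists [` yY]%fset.
  rewrite lee_fin; have [I0 I1] := lawY.
  have -> : \sum_(y : Y) I (val y) * \sum_b P (val y) b * (1 - fails R rel (val y) (out b)) =
     1 - \sum_(y : Y) I (val y) * \sum_b P (val y) b * fails R rel (val y) (out b).
    rewrite -[X in X - _]I1 -sumrB; apply: eq_bigr => y _.
    rewrite -[X in _ = X - _]mulr1 -mulrBr; congr (_ * _).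
    have [_ P1] := lawP (val y); rewrite -[X in _ = X - _]P1 -sumrB.
    by apply: eq_bigr => b _; rewrite mulrBr mulr1.
  by rewrite lerD2l lerN2.
- move=> y y' Iy Iy' Ayy'.
  apply: le_trans (close [` IY _ Iy]%fset [` IY _ Iy']%fset Ayy') _.
  rewrite -/u; have pu k : 0 < u ^+ k by rewrite exprn_gt0.
  have -> : u ^+ 18 * u ^+ 5 * (20 * (u ^+ 46)^-1) = 20 / u ^+ 22 * u^-1.
    by field; rewrite gt_eqF.
  rewrite ler_piMl ?invr_ge0 ?(ltW u0) // ler_pdivrMr // mul1r.
  by apply: (@le_trans _ _ u) => //; rewrite -[leLHS]expr1 ler_weXn2l.
Qed.

(** * Decoders *)

Section Decoding.
Variables (R : realType) (n r : nat) (I : 'rV[int]_n -> R) (O : Type).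
Variables (rel : 'rV[int]_n -> O -> Prop) (delta : R) (s p : nat).
Variables (A : linear_sketch R n p 0) (C : finType).
Variables (P : 'rV[int]_n -> C -> R) (out : C -> O).
Hypothesis sim : simulates r I rel delta s A P out.
Hypothesis pI : is_pmf I.
Hypothesis finI : finite_set [set y | I y != 0].

Let Y := fset_set [set y | I y != 0].

Let IY y : I y != 0 -> y \in Y.
Proof. by move=> h; rewrite /Y in_fset_set //; exact/mem_set. Qed.

Let YI (y : Y) : I (val y) != 0.
Proof. by have := valP y; rewrite /= /Y in_fset_set // => /set_mem. Qed.

Let lawY := law_support pI IY.

Definition fail_rate (y : 'rV[int]_n) : R := \sum_b P y b * fails R rel y (out b).

Let lawP y : law (P y). Proof. by case: sim. Qed.

Lemma fail_rateE y : \sum_b P y b * (1 - fails R rel y (out b)) = 1 - fail_rate y.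
Proof.
have [_ P1] := lawP y; rewrite -[X in _ = X - _]P1 -sumrB.
by apply: eq_bigr => b _; rewrite mulrBr mulr1.
Qed.

Lemma fail_rate_ge0 y : 0 <= fail_rate y.
Proof. by apply: sumr_ge0 => b _; rewrite mulr_ge0 //; case: (lawP y). Qed.

Lemma fail_rate_le1 y : fail_rate y <= 1.
Proof.
have [P0 <-] := lawP y; apply: ler_sum => b _.
by rewrite ler_piMr // lern1 leq_b1.
Qed.

Lemma prob_supported (E : set 'rV[int]_n) :
  prob I E = (\sum_(y : Y) if val y \in E then I (val y) else 0)%:E.
Proof.
rewrite /prob esum_mkcond.
rewrite -(@esum_EFin_supported R Y _ val (fun y => if y \in E then I y else 0)) //.
- by apply: eq_esum => y _; case: ifP.
- by move=> y; case: ifP => // _; case: pI.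
- by move=> y; case: ifP => [_ /IY yY|_]; [exists [` yY]%fset | rewrite eqxx].
Qed.

Lemma mean_success : 1 - 2 * delta <= \sum_(y : Y) I (val y) * (1 - fail_rate (val y)).
Proof.
case: sim => _ _ + _; rewrite (@esum_EFin_supported R Y _ val) //.
- by rewrite lee_fin; under eq_bigr do rewrite fail_rateE.
- by move=> y; rewrite fail_rateE mulr_ge0 // ?subr_ge0 ?fail_rate_le1 //; case: pI.
- by move=> y; rewrite mulf_eq0 negb_or => /andP[/IY yY _]; exists [` yY]%fset.
Qed.

(** The indicator [fails] lies in [[0, 1]], so exchanging laws costs at most their L1 distance. *)
Lemma fail_rate_close y y' : I y != 0 -> I y' != 0 -> A y = A y' ->
  \sum_b P y b * fails R rel y' (out b) <= fail_rate y' + (root50 R r)^-1.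
Proof.
move=> Iy Iy' Ayy'; have [_ _ _ /(_ y y' Iy Iy' Ayy')] := sim.
move=> close; apply: le_trans (lerD (lexx _) close); rewrite -big_split /=.
apply: ler_sum => b _; rewrite -lerBlDl -mulrBl.
apply: le_trans (ler_norm _) _; rewrite normrM ler_piMr //.
by rewrite ger0_norm ?lern1 ?leq_b1.
Qed.

(* A good vector fails with probability less than [1/4], so two good vectors with the same
   sketch share an output that is valid for both. *)
Definition good : set 'rV[int]_n := [set y | I y != 0 /\ fail_rate y < 1 / 4].

(** Markov's inequality: the mean failure rate is at most [2 * delta] and the threshold is [1/4],
    whence the factor 8. *)
Lemma prob_good : ((1 - 8 * delta)%:E <= prob I good)%E.
Proof.
rewrite prob_supported lee_fin; have [I0 I1] := lawY.
suff : \sum_(y : Y) I (val y) * (1 - fail_rate (val y)) <=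
    3 / 4 * \sum_(y : Y) I (val y) +
    1 / 4 * \sum_(y : Y) if val y \in good then I (val y) else 0.
  by have := mean_success; rewrite I1; lra.
rewrite !mulr_sumr -big_split /=; apply: ler_sum => y _.
have h0 := fail_rate_ge0 (val y); have Iy0 := I0 y.
case: ifPn => hy; first by nra.
suff : 1 / 4 <= fail_rate (val y) by nra.
rewrite leNgt; apply/negP => hf; move/negP: hy; apply; apply/mem_set.
by split; [exact: YI | exact: hf].
Qed.

Lemma good_common y y' : 4 <= root50 R r -> good y -> good y' -> A y = A y' ->
  exists o, rel y o /\ rel y' o.
Proof.
move=> u4 [Iy fy] [Iy' fy'] Ayy'; apply: contrapT => hno.
have u14 : (root50 R r)^-1 <= 1 / 4.
  by rewrite mul1r lef_pV2 ?posrE //; lra.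
have close := fail_rate_close Iy Iy' Ayy'.
(* Without a common valid output each [b] fails for [y] or [y'], yet under [P y] the two failure
   probabilities total less than [1/4 + 1/2]. *)
suff : 1 <= fail_rate y + \sum_b P y b * fails R rel y' (out b) by lra.
have [P0 <-] := lawP y; rewrite -big_split /=; apply: ler_sum => b _.
rewrite -mulrDr ler_peMr // /fails.
case: asboolP => [|ny]; first by rewrite lerDl.
case: asboolP => [|ny']; first by rewrite lerDr.
by exfalso; apply: hno; exists (out b); split; apply: contrapT.
Qed.

Lemma exists_output : exists o : O, True.
Proof.
have [P0 P1] := lawP 0.
have [b _] : exists b : C, True.
  apply: contrapT => h; move: P1; rewrite big1 => [/eqP|b _]; last by case: h; exists b.
  by rewrite eq_sym oner_eq0.
by exists (out b).
Qed.

End Decoding.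

Lemma prob_subset (R : realType) (T : choiceType) (p : T -> R) (A B : set T) :
  (forall x, 0 <= p x) -> A `<=` B -> (prob p A <= prob p B)%E.
Proof.
move=> p0 AB; rewrite /prob esum_mkcond [leRHS]esum_mkcond; apply: le_esum => x _.
case: ifPn => [/set_mem/AB/mem_set->//|_]; case: ifP => // _.
by rewrite lee_fin.
Qed.

Section RandomDecoder.
Variables (R : realType) (n r : nat) (I : 'rV[int]_n -> R) (O : choiceType).
Variables (rel : 'rV[int]_n -> O -> Prop) (delta : R) (s p : nat).
Variables (A : linear_sketch R n p 0) (C : finType).
Variables (P : 'rV[int]_n -> C -> R) (out : C -> O).
Hypothesis sim : simulates r I rel delta s A P out.
Hypothesis pI : is_pmf I.
Hypothesis finI : finite_set [set y | I y != 0].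
Hypothesis delta_large : (root50 R r)^-1 <= delta.

Let lawP y : law (P y). Proof. by case: sim. Qed.

Let F : {fset O} := [fset out b | b in C]%fset.

Let outF b : out b \in F. Proof. exact: in_imfset. Qed.

Definition output_law (y : 'rV[int]_n) (o : O) : R := \sum_b P y b * (out b == o)%:R.

Let output_law_ge0 y o : 0 <= output_law y o.
Proof. by apply: sumr_ge0 => b _; rewrite mulr_ge0 //; case: (lawP y). Qed.

Let output_law_neq0 y o : output_law y o != 0 -> o \in F.
Proof.
apply: contraNT => oF; rewrite /output_law big1 // => b _.
by case: eqP => [e|_]; [rewrite -e outF in oF | rewrite mulr0].
Qed.

Let sum_output_law y (h : O -> R) : \sum_(o : F) output_law y (val o) * h (val o) =
  \sum_b P y b * h (out b).
Proof.
under eq_bigr do rewrite mulr_suml.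
rewrite exchange_big /=; apply: eq_bigr => b _.
rewrite (bigD1 [` outF b]%fset) //= eqxx mulr1 big1 ?addr0 // => o ob.
case: eqP => [e|_]; last by rewrite mulr0 mul0r.
by case/eqP: ob; apply: val_inj.
Qed.

Lemma pmf_output_law y : is_pmf (output_law y).
Proof.
split; first exact: output_law_ge0.
rewrite (@esum_EFin_supported R F _ val) //.
  have := sum_output_law y (fun=> 1); under eq_bigr do rewrite mulr1.
  by move=> ->; under eq_bigr do rewrite mulr1; case: (lawP y) => _ ->.
by move=> o /output_law_neq0 oF; exists [` oF]%fset.
Qed.

(** The decoder samples the output law at a representative of the fibre. Failure is at most
    [2 * delta] on average, and the change of law adds [u ^ -1 <= delta]. *)
Lemma random_decoder : exists g : sketch_group R p 0 -> O -> R,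
  (forall a, is_pmf (g a)) /\
  ((1 - 3 * delta)%:E <=
     prob (fun z : 'rV[int]_n * O => (I z.1 * g (A z.1) z.2)%R) [set z | rel z.1 z.2])%E.
Proof.
have /choice[rep hrep] (a : sketch_group R p 0) : exists y0 : 'rV[int]_n,
    (exists2 y, I y != 0 & A y = a) -> I y0 != 0 /\ A y0 = a.
  have [[y Iy Ay]|h] := pselect (exists2 y, I y != 0 & A y = a); first by exists y.
  by exists 0.
exists (fun a => output_law (rep a)); split=> [a|]; first exact: pmf_output_law.
pose Y := fset_set [set y | I y != 0].
have IY y : I y != 0 -> y \in Y by move=> h; rewrite /Y in_fset_set //; exact/mem_set.
have YI (y : Y) : I (val y) != 0.
  by have := valP y; rewrite /= /Y in_fset_set // => /set_mem.
have [I0 I1] := law_support pI IY.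
pose emb (z : Y * F) := (val z.1, val z.2).
have emb_inj : injective emb by move=> [y o] [y' o'] [/val_inj-> /val_inj->].
rewrite /prob esum_mkcond.
pose v (z : 'rV[int]_n * O) : R :=
  I z.1 * output_law (rep (A z.1)) z.2 * (1 - fails R rel z.1 z.2).
have -> : \esum_(z in [set: 'rV[int]_n * O]) (if z \in [set z | rel z.1 z.2]
    then (I z.1 * output_law (rep (A z.1)) z.2)%:E else 0%E) =
    \esum_(z in [set: 'rV[int]_n * O]) (v z)%:E.
  apply: eq_esum => z _; rewrite /v /fails; case: ifPn => [/set_mem h|h].
    by rewrite asboolF ?subr0 ?mulr1 // => /(_ h).
  rewrite asboolT ?subrr ?mulr0 // => hz; move/negP: h; apply; exact/mem_set.
rewrite (@esum_EFin_supported R (Y * F)%type _ emb v) //; first last.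
- move=> [y o]; rewrite /v /= !mulf_eq0 !negb_or => /andP[/andP[/IY yY /output_law_neq0 oF] _].
  by exists ([` yY]%fset, [` oF]%fset).
- move=> z; rewrite /v !mulr_ge0 //; first by case: pI.
  by rewrite subr_ge0 lern1 leq_b1.
rewrite lee_fin -(pair_big xpredT xpredT (fun (y : Y) (o : F) => v (emb (y, o)))) /=.
apply: (@le_trans _ _ (\sum_(y : Y) I (val y) * (1 - fail_rate rel P out (val y) - delta))).
  have := mean_success sim pI finI => hm.
  under eq_bigr do rewrite mulrBr; rewrite sumrB -mulr_suml I1 mul1r.
  by move: hm; rewrite -/Y; lra.
apply: ler_sum => y _; under eq_bigr do rewrite /v /emb /= -mulrA.
rewrite -mulr_sumr ler_wpM2l //.
rewrite (sum_output_law _ (fun o => 1 - fails R rel (val y) o)).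
have [Irep Arep] : I (rep (A (val y))) != 0 /\ A (rep (A (val y))) = A (val y).
  by apply: hrep; exists (val y); first exact: YI.
have close := fail_rate_close sim Irep (YI y) Arep.
have [_ P1] := lawP (rep (A (val y))).
under eq_bigr do rewrite mulrBr mulr1.
by rewrite sumrB P1; move: close delta_large; lra.
Qed.

End RandomDecoder.

Theorem theorem6p1p3 (R : realType) (c1 c2 : R) (c1_gt0 : 0 < c1) :
  exists C r0 : nat,
  forall (n r : nat) (rho D : R) (I : 'rV[int]_n -> R) (s : nat) (delta : R),
    (r0 <= r)%N -> (n ^ 50 <= r)%N ->
    truncation_radius n c1 c2 r rho ->
    is_pmf I -> support_diam_le I D -> D <= r%:R `^ 3^-1 ->
    [/\ (forall (M : metricType R) (f : 'rV[int]_n -> M) (outs : set M) (eps : R),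
          0 <= eps ->
          solvable_in_space r rho I (metric_rel f outs eps) delta s ->
          exists (p q : nat) (A : linear_sketch R n p q),
            sketch_within A C r s /\
            exists g : sketch_group R p q -> outs,
              ((1 - 8 * delta)%:E <=
                 prob I [set y | (mdist (\val (g (A y))) (f y) <= 3 * eps)%R])%E),
        (forall f : 'rV[int]_n -> option bool,
          solvable_in_space r rho I (promise_rel f) delta s ->
          exists (p q : nat) (A : linear_sketch R n p q),
            sketch_within A C r s /\
            exists g : sketch_group R p q -> bool,
              ((1 - 8 * delta)%:E <= prob I [set y | promise_rel f y (g (A y))])%E) &
        (forall (O : choiceType) (rel : 'rV[int]_n -> O -> Prop),
          solvable_in_space r rho I rel delta s ->
          0 < delta -> delta ^- 50 <= r%:R ->
          exists (p q : nat) (A : linear_sketch R n p q),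
            sketch_within A C r s /\
            exists g : sketch_group R p q -> O -> R,
              (forall a, is_pmf (g a)) /\
              ((1 - 3 * delta)%:E <=
                 prob (fun z : 'rV[int]_n * O => (I z.1 * g (A z.1) z.2)%R)
                      [set z | rel z.1 z.2])%E)].
Proof.
have [r0 [r0_gt1 core]] := simulation c1 c2.
exists 288%N, r0 => n r rho D I s delta hr hn hrho pI diam hD.
have [_ finI] := pmf_support_finite pI diam.
have I0 x : 0 <= I x by case: pI.
split.
- move=> M f outs eps eps0 sol.
  have [u4 _ [p [A [C [P [out sim]]]]]] := core n r rho D I s delta _ _ hr hn hrho pI diam hD sol.
  exists p, 0%N, A; split; first by case: sim.
  have [z0 _] := exists_output sim.
  have /choice[g hg] (a : sketch_group R p 0) : exists z : outs,
      forall y, good I (metric_rel f outs eps) P out y -> A y = a ->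
        mdist (\val z) (f y) <= 3 * eps.
    have [[y0 gy0 Ay0]|h] := pselect (exists2 y0, good I (metric_rel f outs eps) P out y0 & A y0 = a);
      last by exists z0 => y gy Ay; case: h; exists y.
    (* Any output [z] valid for one good [y0] of the fibre will do: the output [z'] common to [y]
       and [y0] links [z] to [f y] in three steps of length [eps]. *)
    have [z [ho _]] := good_common sim u4 gy0 gy0 erefl.
    exists z => y gy Ay.
    have [z' [h1 h2]] := good_common sim u4 gy gy0 (etrans Ay (esym Ay0)).
    move: ho h1 h2; rewrite /metric_rel => ho h1 h2.
    have t1 := metric_triangle (\val z) (f y0) (f y).
    have t2 := metric_triangle (f y0) (\val z') (f y).
    by rewrite metric_sym in h2; lra.
  exists g; apply: le_trans (prob_good sim pI finI) _.
  by apply: prob_subset => // y gy /=; exact: hg.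
- move=> f sol.
  have [u4 _ [p [A [C [P [out sim]]]]]] := core n r rho D I s delta _ _ hr hn hrho pI diam hD sol.
  exists p, 0%N, A; split; first by case: sim.
  have /choice[g hg] (a : sketch_group R p 0) : exists z : bool,
      forall y, good I (promise_rel f) P out y -> A y = a -> promise_rel f y z.
    (* A definite value at one good vector of the fibre is forced on all others through common
       outputs; if there is none, any bit is valid. *)
    have [[y0 [gy0 Ay0 [b fy0]]]|h] := pselect (exists y0,
        [/\ good I (promise_rel f) P out y0, A y0 = a & exists b, f y0 = Some b]).
      exists b => y gy Ay.
      have [z [h1 h2]] := good_common sim u4 gy gy0 (etrans Ay (esym Ay0)).
      by case: h2; rewrite fy0 // => -[->].
    exists true => y gy Ay; left; case fy : (f y) => [b|//].
    by case: h; exists y; split=> //; exists b.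
  exists g; apply: le_trans (prob_good sim pI finI) _.
  by apply: prob_subset => // y gy /=; exact: hg.
- move=> O rel sol delta0 hdelta.
  have [u4 ur [p [A [C [P [out sim]]]]]] := core n r rho D I s delta _ _ hr hn hrho pI diam hD sol.
  exists p, 0%N, A; split; first by case: sim.
  apply: (random_decoder sim pI finI).
  (* Taking 50th roots in [delta ^- 50 <= r] gives [delta^-1 <= root50]. *)
  rewrite -[leRHS]invrK lef_pV2 ?posrE ?invr_gt0 //; last by lra.
  by rewrite -(@ler_pXn2r _ 50) ?nnegrE ?invr_ge0 ?(ltW delta0) ?ur ?exprVn //; lra.
Qed.
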